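(* Let $m, n$ be positive integers with $m \le n$, let $U$ be an open subset of $\mathbf{R}^n$, let $V \in \mathbf{V}_m(U)$ be a varifold such that $\|\delta V\|$ is a Radon measure, let $E$ be $\|V\| + \|\delta V\|$ measurable with $V\partial E = 0$, and let $W = V \llcorner (E \times \mathbf{G}(n,m))$. Then $$\|\delta V\| = \|\delta W\| + \|\delta(V-W)\|.$$
   Context: $\mathbf{G}(n,m)$ is the Grassmannian of $m$-dimensional linear subspaces of $\mathbf{R}^n$. An $m$-dimensional varifold in $U$, $V \in \mathbf{V}_m(U)$, is a Radon measure on $U \times \mathbf{G}(n,m)$; its weight is $\|V\|(A) = V(A \times \mathbf{G}(n,m))$. $V\llcorner (E\times \mathbf{G}(n,m))$ is the restriction of the measure $V$ to $E\times\mathbf{G}(n,m)$. The first variation is the distribution $\delta V(g) = \int \mathrm{trace}(S_\natural \circ Dg(x)) \, dV(x,S)$ for $g \in C_c^\infty(U,\mathbf{R}^n)$, with $S_\natural$ the orthogonal projection onto $S$. For a distribution $T$ on $C_c^\infty(U,\mathbf{R}^n)$, $\|T\|$ is the largest Borel regular measure over $U$ with $\|T\|(G) = \sup\{T(g) : g \in C_c^\infty(U,\mathbf{R}^n), \operatorname{spt} g \subset G, |g| \le 1\}$ for every open $G \subset U$. If $\|T\|$ is a Radon measure, $T$ is extended uniquely by continuity to $\mathbf{L}_1(\|T\|,\mathbf{R}^n)$, and for a $\|T\|$ measurable set $A$, the distribution $T\llcorner A$ is $(T\llcorner A)(g) = T(g_A)$, where $g_A = g$ on $A$ and $g_A = 0$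 on $U\setminus A$. If $\|\delta V\|$ is a Radon measure and $E$ is $\|V\|+\|\delta V\|$ measurable, the distributional $V$ boundary of $E$ is the distribution $$V\partial E = (\delta V)\llcorner E - \delta\big(V\llcorner (E\times\mathbf{G}(n,m))\big).$$ *)

(* Defs.v *)
From HB Require Import structures.
From mathcomp Require Import all_boot all_order all_algebra.
From mathcomp Require Import all_classical all_reals all_analysis.
Set Implicit Arguments.
Unset Strict Implicit.
Unset Printing Implicit Defensive.
Import Order.TTheory GRing.Theory Num.Theory.
Import numFieldNormedType.Exports.
Local Open Scope classical_set_scope.
Local Open Scope ring_scope.

(** Vectors are row vectors, so a linear map is [v |-> v *m A], and the matrix
    of [S_natural \o Dg x] is [jacobian g x *m orthproj S]. *)

(** The norm of ['rV_n] in the library is the sup norm. *)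
Definition enorm (R : realType) (n : nat) (x : 'rV[R]_n) : R :=
  Num.sqrt (\sum_(i < n) x 0 i ^+ 2).

(** [kermx B^T] consists of the [v] with [v *m B^T = 0], i.e. orthogonal to all
    rows of [B], which form a basis of [S]. *)
Definition orthproj (R : realType) (n : nat) (S : {vspace 'rV[R]_n}) : 'M[R]_n :=
  let B : 'M[R]_(\dim S, n) := \matrix_(i < \dim S) (vbasis S)`_i in
  proj_mx <<B>>%MS (kermx B^T).

Lemma orthprojP (R : realType) (n : nat) (S : {vspace 'rV[R]_n}) (v : 'rV[R]_n) :
  v *m orthproj S \in S /\
  forall w, w \in S -> (v - v *m orthproj S) *m w^T = 0.
Proof.
rewrite /orthproj.
set B := (X in <<X>>%MS).
have BS w : (w <= B)%MS = (w \in S).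
  apply/idP/idP.
    move=> /submxP[D ->]; rewrite mulmx_sum_row; apply: memv_suml => i _.
    rewrite rowK; apply: memvZ; apply: vbasis_mem.
    by apply: mem_nth; rewrite size_tuple.
  move=> wS; rewrite (coord_vbasis wS); apply: summx_sub => i _.
  apply: scalemx_sub; have <- : row i B = (vbasis S)`_i by rewrite rowK.
  exact: row_sub.
have pos (u : 'rV[R]_n) : u *m u^T = 0 -> u = 0.
  move=> /matrixP/(_ 0 0); rewrite !mxE => h; apply/rowP => i; rewrite mxE.
  move/eqP: h; rewrite psumr_eq0; last by move=> j _; rewrite mxE -expr2 sqr_ge0.
  by move=> /allP/(_ i (mem_index_enum _)); rewrite mxE mulf_eq0 orbb => /eqP.
have cap0 : (<<B>> :&: kermx B^T)%MS = 0.
  apply/eqP/rowV0P => u; rewrite sub_capmx genmxE.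
  move=> /andP[/submxP[D uD] /sub_kermxP uk].
  by apply: pos; rewrite {2}uD trmx_mul mulmxA uk mul0mx.
split; first by rewrite -BS -(genmxE B); exact: proj_mx_sub.
move=> w; rewrite -BS => /submxP[D ->].
have full : (v <= <<B>> + kermx B^T)%MS.
  apply: submx_full.
  rewrite /row_full; have := mxrank_sum_cap <<B>>%MS (kermx B^T).
  rewrite cap0 mxrank0 addn0 => ->; rewrite genmxE mxrank_ker mxrank_tr subnKC //.
  exact: rank_leq_col.
rewrite trmx_mul mulmxA.
have -> : (v - v *m proj_mx <<B>>%MS (kermx B^T)) *m B^T = 0.
  by apply/sub_kermxP; exact: proj_mx_compl_sub.
by rewrite mul0mx.
Qed.

(** All linear subspaces of [R^n], with the topology induced by identifying a
    subspace with its orthogonal projection; the Grassmannian [G(n, m)] is the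
    set of those of dimension [m]. *)
Definition subspaces (R : realType) (n : nat) : Type :=
  initial_topology (@orthproj R n).

HB.instance Definition _ (R : realType) (n : nat) :=
  Topological.copy (subspaces R n) (initial_topology (@orthproj R n)).
HB.instance Definition _ (R : realType) (n : nat) :=
  isPointed.Build (subspaces R n) (0%VS : {vspace 'rV[R]_n}).

Definition grassmannian (R : realType) (n m : nat) : set (subspaces R n) :=
  [set S | \dim (S : {vspace 'rV[R]_n}) = m].

(** Measures are defined on all subsets (outer measures), and measurability is
    Caratheodory's. A measure over a subset [X] of a space [T] is encoded as an
    outer measure on [T] for which the complement of [X] is a null set. *)
Section measures_over.
Context (R : realType) (T : topologicalType).
Implicit Types (X A B : set T) (mu : {outer_measure set T -> \bar R}).

Definition relopen X : set (set T) := [set G `&` X | G in open].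

Definition radon_over X mu :=
  [/\ mu (~` X) = 0%E,
      forall K, compact K -> K `<=` X -> (mu K < +oo)%E,
      forall G, relopen X G -> mu.-caratheodory G,
      forall G, relopen X G ->
        mu G = ereal_sup [set mu K | K in [set K | compact K /\ K `<=` G]]
    & forall A, A `<=` X ->
        mu A = ereal_inf [set mu G | G in [set G | relopen X G /\ A `<=` G]]].

Definition borel_regular_over X mu :=
  [/\ mu (~` X) = 0%E,
      forall G, relopen X G -> mu.-caratheodory G
    & forall A, A `<=` X -> exists B,
        [/\ <<s X, relopen X >> B, A `<=` B & mu B = mu A]].

End measures_over.

Section outer_constructions.
Context (R : realType) (T : Type).
Implicit Types (mu : {outer_measure set T -> \bar R}).

Definition ozero (_ : set T) : \bar R := 0%E.

Let ozero_sub : sigma_subadditive ozero.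
Proof. by move=> F; rewrite eseries0. Qed.

HB.instance Definition _ := isOuterMeasure.Build R T ozero
  erefl (fun _ => lexx _) (fun _ _ _ => lexx _) ozero_sub.

Definition orestr mu (B : set T) (A : set T) : \bar R := mu (A `&` B).

Section orestr_instance.
Variables (mu : {outer_measure set T -> \bar R}) (B : set T).

Let orestr0 : orestr mu B set0 = 0%E.
Proof. by rewrite /orestr set0I outer_measure0. Qed.

Let orestr_ge0 A : (0 <= orestr mu B A)%E.
Proof. exact: outer_measure_ge0. Qed.

Let orestr_le : {homo orestr mu B : A A' / A `<=` A' >-> (A <= A')%E}.
Proof. by move=> A A' AA'; apply: le_outer_measure; exact: setSI. Qed.

Let orestr_sub : sigma_subadditive (orestr mu B).
Proof.
by move=> F; rewrite /orestr setI_bigcupl; exact: outer_measure_sigma_subadditive.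
Qed.

HB.instance Definition _ := isOuterMeasure.Build R T (orestr mu B)
  orestr0 orestr_ge0 orestr_le orestr_sub.
End orestr_instance.

(** "The measure such that [P]"; the zero measure if there is none. *)
Definition the_measure (P : {outer_measure set T -> \bar R} -> Prop) :
    {outer_measure set T -> \bar R} :=
  if pselect (exists mu, P mu) is left h then projT1 (cid h) else ozero.

End outer_constructions.

Section test_functions.
Context (R : realType) (n : nat).
Implicit Types (U A : set 'rV[R]_n) (g : 'rV[R]_n -> 'rV[R]_n).

Fixpoint Ck (k : nat) g : Prop :=
  if k is k'.+1 then
    (forall x, differentiable g x) /\ forall v, Ck k' (fun x => 'd g x v)
  else continuous g.

Definition spt g : set 'rV[R]_n := closure [set x | g x != 0].

(** Elements of [C_c^oo(U, R^n)] are extended by zero to [R^n]. *)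
Record test_fun U := TestFun {
  test_val :> 'rV[R]_n -> 'rV[R]_n ;
  test_smooth : forall k, Ck k test_val ;
  test_compact : compact (spt test_val) ;
  test_sub : spt test_val `<=` U }.

(** Distributions are used only through their values, so functionals suffice. *)
Definition dist_variation_class U (T : test_fun U -> R)
    (mu : {outer_measure set 'rV[R]_n -> \bar R}) : Prop :=
  borel_regular_over U mu /\
  forall G, open G -> G `<=` U ->
    mu G = ereal_sup [set (T g)%:E | g in
      [set g : test_fun U | spt g `<=` G /\ forall x, enorm (g x) <= 1]].

Definition dist_variation U (T : test_fun U -> R) :
    {outer_measure set 'rV[R]_n -> \bar R} :=
  the_measure (fun mu => dist_variation_class T mu /\
    forall nu, dist_variation_class T nu -> forall A, (nu A <= mu A)%E).

(** Extension of [T] by continuity to [L_1(dist_variation T, R^n)]: the limit of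
    [T (g k)] for test functions [g k] converging to [f] in [L_1]. *)
Definition L1_extension U (T : test_fun U -> R) (f : 'rV[R]_n -> 'rV[R]_n) : R :=
  let mu := dist_variation T in
  get [set l : R | exists g : nat -> test_fun U,
    ((\int[(mu : set (caratheodory_type mu) -> \bar R)]_x
       (enorm (g k x - f x))%:E)%E @[k --> \oo] --> 0%E) /\
    (T (g k) @[k --> \oo] --> l)].

Definition dist_restr U (T : test_fun U -> R) A : test_fun U -> R :=
  fun g : test_fun U => L1_extension T (fun x => if x \in A then g x else 0).

End test_functions.

Section varifolds.
Context (R : realType) (n : nat).
Local Notation varifold_measure :=
  {outer_measure set ('rV[R]_n * subspaces R n)%type -> \bar R}.
Implicit Types (V W : varifold_measure) (U E : set 'rV[R]_n) (m : nat).

Definition varifold m U V := radon_over (U `*` @grassmannian R n m) V.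

Definition weight m V (A : set 'rV[R]_n) : \bar R :=
  V (A `*` @grassmannian R n m).

Definition first_variation U V : test_fun U -> R := fun g =>
  (fine (\int[(V : set (caratheodory_type V) -> \bar R)]_p
          (\tr (jacobian g p.1 *m orthproj p.2))%:E))%E.
Arguments first_variation : clear implicits.

Definition varifold_restr m V E : varifold_measure :=
  orestr V (E `*` @grassmannian R n m).

(** [V - W] is the varifold whose sum with [W] is [V] (a setwise difference
    would involve [+oo - +oo]). *)
Definition varifold_sub m U V W : varifold_measure :=
  the_measure (fun D => varifold m U D /\ forall A, V A = (W A + D A)%E).

Definition dist_boundary m U V E : test_fun U -> R := fun g =>
  dist_restr (first_variation U V) E g -
  first_variation U (varifold_restr m V E) g.

Arguments dist_boundary : clear implicits.

End varifolds.
Arguments first_variation {R n} U V _.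
Arguments dist_boundary {R n} m U V E _.

(* Main.v *)
Require Import Defs.
From HB Require Import structures.
From mathcomp Require Import all_boot all_order all_algebra.
From mathcomp Require Import all_classical all_reals all_analysis.
From mathcomp Require Import measurable_realfun.
From mathcomp Require Import ring lra.
Set Implicit Arguments.
Unset Strict Implicit.
Unset Printing Implicit Defensive.
Import Order.TTheory GRing.Theory Num.Theory.
Import numFieldNormedType.Exports.
Local Open Scope classical_set_scope.
Local Open Scope ring_scope.

(** Write [T] for the first variation of [V], [mu] for its total variation and
    [W], [V - W] for the restrictions of [V] to the cylinders over [E] and over
    its complement.  That the distributional boundary of [E] vanishes says that
    the first variation of [W] at [g] is [T] at the cut-off field [g_E]; by
    additivity of the integral, that of [V - W] at [g] is [T] at [g - g_E].

    Inside a bounded open set, approximate [E] in [mu] by a compact [K] from the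
    inside and let [c] be a smooth function which is [1] near [K] and vanishes
    off a slightly larger open set.  Then [c g] tends to [g_E] in [L_1(mu)], and
    [T] is continuous for that norm, because [T h] is at most a constant times
    the [mu]-integral of [|h|].  As [c g] lives near [K] and [(1 - c) g] away
    from [K], the total variations of the two pieces on an open [G] are at most
    [mu (G `&` E)] and [mu (G `\` E)].  They add up to at least [mu G], so both
    are equalities; outer regularity carries them to arbitrary sets. *)

(** * Smooth functions *)

(** Three objects are defined by choice, with a default value: the largest measure with given values
    on open sets, the extended functional (through [get]), and the varifold [V - W]. Existence has
    to be proved before any of them can be computed. For the first, an outer regular candidate
    dominates its competitors. For the second, a Cauchy sequence of test fields is built. For the
    third, the restriction of [V] to the complement of the cylinder over [E] has to be a varifold,
    so the cylinder must be [V] measurable, whereas the hypothesis on [E] only concerns the sum of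
    the weight and [mu]. The integral bound only identifies limits, so any constant will do there;
    the sharp inequalities come from evaluating [T] on fields supported in suitable open sets.
    Cancelling to get equalities needs finite values while [mu] is only locally finite, hence the
    exhaustion of [U] by compact sets. *)

Section smooth_functions.
Context (R : realType) (n : nat).
Local Notation V := 'rV[R]_n.

(* [Ck] of [Defs] for functions with values in any normed space. *)
Fixpoint Ck_in (W : normedModType R) (k : nat) (g : V -> W) : Prop :=
  if k is k'.+1 then
    (forall x, differentiable g x) /\ forall v, Ck_in k' (fun x => 'd g x v)
  else continuous g.

Lemma Ck_inE k (g : V -> V) : Ck_in k g = Ck k g.
Proof.
elim: k g => [//|k IH] g /=; congr (_ /\ _).
by apply: eq_forall => v; rewrite IH.
Qed.

Lemma Ck_in_continuous (W : normedModType R) k (g : V -> W) :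
  Ck_in k g -> continuous g.
Proof. by case: k => [//|k [dg _]] x; exact: differentiable_continuous. Qed.

Lemma Ck_inW (W : normedModType R) k (g : V -> W) :
  Ck_in k.+1 g -> Ck_in k g.
Proof.
elim: k g => [|k IH] g; first by move/(@Ck_in_continuous _ 1).
by move=> [dg cg]; split=> // v; apply: IH; exact: cg.
Qed.

Lemma Ck_in_cst (W : normedModType R) k (c : W) : Ck_in k (fun=> c).
Proof.
elim: k c => [|k IH] c /=; first exact: cst_continuous.
split=> [x|v]; first exact: differentiable_cst.
rewrite (_ : (fun _ => _) = fun=> 0); first exact: IH.
by apply/funext => x; rewrite diff_cst.
Qed.

Lemma Ck_in_linear (W : normedModType R) k (f : {linear V -> W}) :
  continuous f -> Ck_in k f.
Proof.
move=> cf; case: k => [//|k] /=.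
split=> [x|v]; first exact: linear_differentiable.
rewrite (_ : (fun _ => _) = fun=> f v); first exact: Ck_in_cst.
by apply/funext => x; rewrite diff_lin.
Qed.

Lemma Ck_inD (W : normedModType R) k (f g : V -> W) :
  Ck_in k f -> Ck_in k g -> Ck_in k (fun x => f x + g x).
Proof.
elim: k f g => [|k IH] f g /= => [cf cg x|[df cf] [dg cg]].
  by apply: continuousD; [exact: cf|exact: cg].
split=> [x|v]; first exact: differentiableD.
rewrite (_ : (fun _ => _) = fun x => 'd f x v + 'd g x v); first exact: IH.
by apply/funext => x; rewrite (@diffD _ _ _ f g).
Qed.

Lemma Ck_in_sum (W : normedModType R) k (I : Type) (r : seq I) (f : I -> V -> W) :
  (forall i, Ck_in k (f i)) -> Ck_in k (fun x => \sum_(i <- r) f i x).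
Proof.
move=> cf; elim: r => [|i r IH].
  by under eq_fun do rewrite big_nil; exact: Ck_in_cst.
by under eq_fun do rewrite big_cons; exact: Ck_inD.
Qed.

(** Declared as a bilinear map so that the product rule below is the derivative of a bilinear map
    composed with a pair. *)
Lemma scaler_is_bilinear (W : lmodType R) :
  bilinear_for (GRing.Scale.Law.clone _ _ ( *:%R : R -> W -> W) _)
    (GRing.Scale.Law.clone _ _ ( *:%R : R -> W -> W) _)
    (@GRing.scale R W).
Proof.
split=> [u'|u] a x y /=; first by rewrite -[a *: x]/(a * x) scalerDl scalerA.
by rewrite scalerDr !scalerA mulrC.
Qed.

HB.instance Definition _ (W : lmodType R) :=
  bilinear_isBilinear.Build R R W W _ _ (@GRing.scale R W)
    (scaler_is_bilinear W).

Lemma differentiable_scaler (W : normedModType R) (c : V -> R) (g : V -> W) x :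
  differentiable c x -> differentiable g x ->
  differentiable (fun x => c x *: g x) x /\
  forall v, 'd (fun x => c x *: g x) x v = 'd c x v *: g x + c x *: 'd g x v.
Proof.
move=> dc dg.
pose b : {bilinear R -> W -> W} := @GRing.scale R W.
have cb : continuous (fun p : R * W => b p.1 p.2) by exact: scale_continuous.
have db := differentiable_bilin (c x, g x) cb.
have dp := differentiable_pair dc dg.
split.
  have := @differentiable_comp _ _ _ _ (fun y => (c y, g y))
    (fun p : R * W => b p.1 p.2) x dp db.
  by [].
move=> v.
rewrite (@diff_comp _ _ _ _ (fun y => (c y, g y)) (fun p : R * W => b p.1 p.2)) //=.
by rewrite diff_bilin // diff_pair //= addrC.
Qed.

Lemma Ck_in_scale (W : normedModType R) k (c : V -> R) (g : V -> W) :
  Ck_in k c -> Ck_in k g -> Ck_in k (fun x => c x *: g x).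
Proof.
elim: k c g => [|k IH] c g => [cc cg x|cc cg].
  by apply: continuousZ; [exact: cc|exact: cg].
have [cc' cg'] := (Ck_inW cc, Ck_inW cg).
case: cc cg => [dc cc] [dg cg] /=.
split=> [x|v]; first exact: (differentiable_scaler (dc x) (dg x)).1.
rewrite (_ : (fun _ => _) = fun x => 'd c x v *: g x + c x *: 'd g x v).
  apply: Ck_inD.
    by apply: (IH (fun x => 'd c x v)); [exact: cc|].
  by apply: (IH c (fun x => 'd g x v)); [|exact: cg].
by apply/funext => x; rewrite (differentiable_scaler (dc x) (dg x)).2.
Qed.

Lemma Ck_in_sub k (c d : V -> R) :
  Ck_in k c -> Ck_in k d -> Ck_in k (fun x => c x + (-1) *: d x).
Proof.
move=> sc sd; apply: Ck_inD => //.
by apply: (@Ck_in_scale _ _ (fun=> -1)) => //; exact: Ck_in_cst.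
Qed.

Lemma Ck_in_inv k (c : V -> R) : (forall x, c x != 0) ->
  Ck_in k c -> Ck_in k (fun x => (c x)^-1).
Proof.
move=> c0; elim: k => [cc x|k IH cc]; first by apply: continuousV => //; exact: cc.
have iV := IH (Ck_inW cc); case: cc => [dc cc].
split=> [x|v]; first exact: differentiableV.
rewrite (_ : (fun _ => _) =
    fun x => (- 1) *: ((c x)^-1 *: ((c x)^-1 *: 'd c x v))).
  apply: Ck_in_scale; first exact: Ck_in_cst.
  by apply: Ck_in_scale => //; apply: Ck_in_scale => //; exact: cc.
apply/funext => x; rewrite diffV //= /GRing.scale /= expr2 invfM; ring.
Qed.

(** A whole family closed under differentiation is composed at once: the chain rule turns [s j] into
    [s j.+1], so the induction on [k] must range over all [j]. *)
Lemma Ck_in_comp k (s : nat -> R -> R) (f : V -> R) :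
  (forall j (t : R), is_derive t (1 : R) (s j) (s j.+1 t)) -> Ck_in k f ->
  forall j, Ck_in k (s j \o f).
Proof.
move=> ds.
have dfs j (t : R) : differentiable (s j) t by apply/derivable1_diffP; apply: ex_derive.
elim: k => [cf j x|k IH cf j].
  apply: continuous_comp; first exact: cf.
  exact: differentiable_continuous.
have if_ := IH (Ck_inW cf); case: cf => df cf.
split=> [x|v]; first exact: differentiable_comp.
rewrite (_ : (fun _ => _) = fun x => (s j.+1 \o f) x *: 'd f x v).
  by apply: Ck_in_scale; [exact: if_|exact: cf].
apply/funext => x; rewrite diff_comp //= diff1E //=.
by rewrite derive1E (@derive_val _ _ _ _ _ _ _ (ds j (f x))) /GRing.scale /= mulrC.
Qed.

End smooth_functions.

(** * Functions flat at the origin *)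

Section flat_function.
Context (R : realType).

(** Induction on [p], with half of the exponent spent on the induction hypothesis and the other half
    on the extra factor [y]. *)
Lemma poly_le_expR (p : {poly R}) (e : R) : 0 < e ->
  exists2 C, 0 < C & forall y, 0 <= y -> `|p.[y]| <= C * expR (e * y).
Proof.
elim/poly_ind: p e => [|p c IH] e e0.
  by exists 1 => // y y0; rewrite horner0 normr0 mul1r expR_ge0.
have e20 : 0 < e / 2 by rewrite divr_gt0.
have [C C0 Cp] := IH _ e20.
exists (C * (2 / e) + `|c| + 1) => [|y y0].
  by rewrite ltr_wpDl // addr_ge0 // ltW // mulr_gt0 // divr_gt0.
rewrite hornerMXaddC (le_trans (ler_normD _ _)) // normrM (ger0_norm y0).
have y1 : y <= (2 / e) * expR (e / 2 * y).
  rewrite -ler_pdivrMl ?divr_gt0 // invf_div.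
  by apply: le_trans (expR_ge1Dx _); rewrite lerDr.
have -> : expR (e * y) = expR (e / 2 * y) * expR (e / 2 * y).
  by rewrite -expRD; congr expR; field.
have e1 : 1 <= expR (e / 2 * y).
  by rewrite -[leLHS]expR0 ler_expR mulr_ge0 // ltW.
set E := expR _ in e1 y1 *.
have := Cp y y0; rewrite -/E; set P := `|p.[y]| => CP.
have E0 : 0 <= E by exact: expR_ge0.
have P0 : 0 <= P by exact: normr_ge0.
have c0 : 0 <= `|c| by [].
have h1 : P * y <= (C * E) * (2 / e * E) by apply: ler_pM.
have h2 : `|c| <= `|c| * (E * E).
  by rewrite ler_peMr // -[X in X <= _]mulr1 ler_pM.
have h3 : 0 <= E * E by rewrite mulr_ge0.
by nra.
Qed.

(** Allowing a polynomial factor in [1/t] makes the class closed under differentiation, by [dflat];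
    the usual [exp(-1/t)] is the case [p = 1]. *)
Definition flat (p : {poly R}) (t : R) : R :=
  if 0 < t then p.[t^-1] * expR (- t^-1) else 0.

Definition dflat (p : {poly R}) : {poly R} := 'X^2 * (p - p^`()).

Lemma is_derive_flat (p : {poly R}) (t : R) :
  is_derive t (1 : R) (flat p) (flat (dflat p) t).
Proof.
have [t0|t0|->] := ltgtP t 0.
- rewrite (_ : flat (dflat p) t = 0); last by rewrite /flat ltNge (ltW t0).
  apply: (@near_eq_is_derive _ _ _ (cst 0)).
  near=> x; rewrite /flat ltNge (_ : x <= 0) //=; apply: ltW.
  by near: x; exact: lt_nbhsl.
- rewrite (_ : flat (dflat p) t = (dflat p).[t^-1] * expR (- t^-1)); last first.
    by rewrite /flat t0.
  have tn0 : t != 0 by rewrite gt_eqF.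
  have dV : is_derive t 1 (fun x : R => x^-1) (- t ^- 2 *: 1).
    exact: (is_deriveV tn0 (is_derive_id _ _)).
  have dp := is_derive1_comp (is_derive_poly p t^-1) dV.
  have dN : is_derive t 1 (fun x : R => - x^-1) (- (- t ^- 2 *: 1)).
    exact: is_deriveN.
  have dE := @is_derive1_comp _ expR (fun x => - x^-1) t _ _ (is_derive_expR (- t^-1)) dN.
  have D : is_derive t (1 : R) (fun x : R => p.[x^-1] * expR (- x^-1))
      ((dflat p).[t^-1] * expR (- t^-1)).
    apply: (is_derive_eq (is_deriveM dp dE)).
    rewrite /= /dflat !hornerE /= /GRing.scale /= !mulr1 -exprVn.
    by ring.
  apply: near_eq_is_derive D.
  near=> x; rewrite /flat (_ : 0 < x) //.
  by near: x; exact: lt_nbhsr.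
- rewrite (_ : flat (dflat p) 0 = 0); last by rewrite /flat ltxx.
  (* The factor ['X^2] yields the bound [C * x ^+ 2] on [flat p], so the difference quotient at 0 is
     at most [C] times the increment. *)
  have [C C0 CP] := @poly_le_expR ('X^2 * p) 1 ltr01.
  have bd x : `|flat p x| <= C * `|x| ^+ 2.
    rewrite /flat; case: ifPn => [x0|_]; last first.
      by rewrite normr0 mulr_ge0 ?exprn_ge0 // ltW.
    have xV0 : 0 <= x^-1 by rewrite invr_ge0 ltW.
    have := CP _ xV0; rewrite !hornerE !normrM (ger0_norm xV0) (gtr0_norm x0).
    rewrite (gtr0_norm (expR_gt0 _)) expRN => h.
    rewrite ler_pdivrMr ?expR_gt0 //.
    have -> : `|p.[x^-1]| = x * x * (x^-1 / x * `|p.[x^-1]|).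
      by field; rewrite gt_eqF.
    apply: le_trans (ler_wpM2l (mulr_ge0 (ltW x0) (ltW x0)) h) _.
    by rewrite le_eqVlt; apply/orP; left; apply/eqP => /=; ring.
  have fl0 : flat p 0 = 0 by rewrite /flat ltxx.
  have cv : (fun h => h^-1 *: ((flat p \o shift 0) (h *: (1:R)) - flat p 0)) @ 0^'
      --> (0 : R).
    apply/cvgrPdist_le => e e0; near=> h.
    have h0 : h != 0 by near: h; exact: nbhs_dnbhs_neq.
    rewrite sub0r normrN /= fl0 subr0 addr0 /GRing.scale /= mulr1 normrM normfV.
    rewrite ler_pdivrMl ?normr_gt0 // (le_trans (bd h)) // expr2 mulrA.
    rewrite [leRHS]mulrC ler_wpM2r // -ler_pdivlMl // mulrC.
    near: h; apply: dnbhs0_le; exact: divr_gt0.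
  by split; [apply/cvg_ex; exists 0|apply: cvg_lim].
Unshelve. all: by end_near. Qed.

End flat_function.

Section enorm_theory.
Context (R : realType) (n : nat).
Local Notation V := 'rV[R]_n.

Lemma enorm_ge0 (x : V) : 0 <= enorm x.
Proof. exact: sqrtr_ge0. Qed.

Lemma enorm_sqr (x : V) : enorm x ^+ 2 = \sum_(i < n) x 0 i ^+ 2.
Proof. by rewrite sqr_sqrtr // sumr_ge0 // => i _; exact: sqr_ge0. Qed.

Lemma enorm0 : enorm (0 : V) = 0.
Proof.
by apply/eqP; rewrite -sqrf_eq0 enorm_sqr big1 // => i _; rewrite mxE expr0n.
Qed.

Lemma enormZ (a : R) (x : V) : enorm (a *: x) = `|a| * enorm x.
Proof.
apply: (@pexpIrn _ 2) => //; rewrite ?nnegrE ?mulr_ge0 ?enorm_ge0 //.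
rewrite exprMn !enorm_sqr mulr_sumr; apply: eq_bigr => i _.
by rewrite mxE exprMn real_normK ?num_real.
Qed.

Lemma enormN (x : V) : enorm (- x) = enorm x.
Proof. by rewrite -scaleN1r enormZ normrN1 mul1r. Qed.

Lemma le_coord_enorm (x : V) i : `|x 0 i| <= enorm x.
Proof.
rewrite -[leRHS]ger0_norm ?enorm_ge0 // -ler_sqr ?nnegrE //.
rewrite !real_normK ?num_real // enorm_sqr (bigD1 i) //= lerDl.
by apply: sumr_ge0 => j _; exact: sqr_ge0.
Qed.

Lemma le_norm_enorm (x : V) : `|x| <= enorm x.
Proof.
rewrite [leLHS]/Num.norm /= mx_normrE; apply/bigmax_leP.
by split=> [|[i j] _ /=]; [exact: enorm_ge0|rewrite ord1 le_coord_enorm].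
Qed.

Lemma enorm_eq0 (x : V) : (enorm x == 0) = (x == 0).
Proof.
apply/eqP/eqP => [x0|->]; last exact: enorm0.
by apply/eqP; rewrite -normr_le0 -x0 le_norm_enorm.
Qed.

(* The factor 2 spares us the Cauchy-Schwarz inequality. *)
Lemma enormD (x y : V) : enorm (x + y) <= 2 * (enorm x + enorm y).
Proof.
rewrite -ler_sqr ?nnegrE ?mulr_ge0 ?addr_ge0 ?enorm_ge0 //.
apply: (@le_trans _ _ (2 * (enorm x ^+ 2 + enorm y ^+ 2))).
  rewrite !enorm_sqr -big_split mulr_sumr; apply: ler_sum => i _ /=.
  by rewrite mxE; have := sqr_ge0 (x 0 i - y 0 i); nra.
by have := enorm_ge0 x; have := enorm_ge0 y; nra.
Qed.

Lemma coord_rV_continuous i : continuous (fun x : V => x 0 i).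
Proof. exact: coord_continuous. Qed.

Lemma enorm_continuous : continuous (@enorm R n).
Proof.
move=> x; apply: (@continuous_comp _ _ _ (fun x : V => \sum_(i < n) x 0 i ^+ 2)).
  apply: (@Ck_in_sum _ _ _ 0) => i y /=.
  by apply: (@continuousM _ _ (fun x : V => x 0 i)); exact: coord_rV_continuous.
exact: sqrt_continuous.
Qed.

End enorm_theory.

(** * Smooth cutoff functions *)

Section smooth_urysohn.
Context (R : realType) (n : nat).
Local Notation V := 'rV[R]_n.

Definition flat1 (t : R) : R := flat 1 t.

Lemma flat1_gt0 t : (0 < flat1 t) = (0 < t).
Proof.
rewrite /flat1 /flat; case: ifPn; rewrite ?ltxx // => _.
by rewrite hornerC mul1r expR_gt0.
Qed.

Lemma flat1_ge0 t : 0 <= flat1 t.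
Proof.
by rewrite /flat1 /flat; case: ifPn => // _; rewrite hornerC mul1r expR_ge0.
Qed.

Lemma flat1_eq0 t : t <= 0 -> flat1 t = 0.
Proof. by rewrite /flat1 /flat leNgt => /negbTE ->. Qed.

Lemma Ck_in_flat1 k (f : V -> R) : Ck_in k f -> Ck_in k (flat1 \o f).
Proof.
move=> cf; apply: (@Ck_in_comp _ _ _ (fun j => flat (iter j (@dflat R) 1)) f _ cf 0%N).
by move=> j t; exact: is_derive_flat.
Qed.

Lemma Ck_in_sqdist k (a : V) (r : R) :
  Ck_in k (fun x => r ^+ 2 - enorm (x - a) ^+ 2).
Proof.
under eq_fun do rewrite enorm_sqr -mulN1r.
apply: Ck_in_sub; first exact: Ck_in_cst.
have cc i : Ck_in k (fun x : V => x 0 i).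
  have lin : linear (fun x : V => x 0 i) by move=> c x y; rewrite !mxE.
  pose lM := GRing.isLinear.Build _ _ _ _ _ lin.
  pose L : {linear V -> R} := HB.pack (fun x : V => x 0 i) lM.
  by apply: (@Ck_in_linear _ _ _ _ L); exact: coord_continuous.
apply: Ck_in_sum => i.
under eq_fun do rewrite mxE expr2.
by apply: Ck_in_scale; apply: Ck_inD => //; exact: Ck_in_cst.
Qed.

(** Positive exactly on an open Euclidean ball: the square of the Euclidean norm is smooth, which
    the sup norm is not. *)
Definition ball_bump (a : V) (r : R) (x : V) : R := flat1 (r ^+ 2 - enorm (x - a) ^+ 2).

Lemma ball_bump_ball a r x : 0 < r -> 0 < ball_bump a r x -> ball a r x.
Proof.
move=> r0; rewrite flat1_gt0 subr_gt0 ltr_sqr ?nnegrE ?enorm_ge0 ?ltW //.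
by rewrite -ball_normE /= distrC; apply: le_lt_trans; exact: le_norm_enorm.
Qed.

Lemma ball_bump_gt0 a r : 0 < r -> 0 < ball_bump a r a.
Proof. by move=> r0; rewrite flat1_gt0 subrr enorm0 expr0n subr0 exprn_gt0. Qed.

Lemma Ck_in_ball_bump k a r : Ck_in k (ball_bump a r).
Proof. by apply: Ck_in_flat1; exact: Ck_in_sqdist. Qed.

Lemma closed_ball_rV_compact (a : V) (r : R) : compact (closed_ball a r).
Proof.
have [r0|r0] := ltP 0 r; last by rewrite closed_ball0 //; exact: compact0.
apply: bounded_closed_compact; last exact: closed_ball_closed.
exists (`|a| + r); split=> [|M rM x]; first exact: num_real.
rewrite closed_ballE // /closed_ball_ /= => xar; apply: le_trans (ltW rM).
by rewrite -lerBlDl (le_trans _ xar) // distrC lerB_dist.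
Qed.

(** A finite sum [s] of bumps is positive on [K] and vanishes off finitely many balls inside [O]; a
    smooth step function of [s] then flattens it to 1 near [K]. *)
Lemma smooth_urysohn (K O : set V) : compact K -> open O -> K `<=` O ->
  exists c : V -> R, [/\ forall k, Ck_in k c,
    compact (closure [set x | c x != 0]), closure [set x | c x != 0] `<=` O,
    forall x, 0 <= c x <= 1 &
    exists N, [/\ open N, K `<=` N & forall x, N x -> c x = 1]].
Proof.
move=> cK oO KO.
have /choice[r rP] (x : V) : exists r, 0 < r /\ (K x -> closed_ball x r `<=` O).
  have [Kx|nKx] := pselect (K x); last by exists 1.
  have /nbhs_closedballP[r rO] : nbhs x O by apply: open_nbhs_nbhs; split=> //; exact: KO.
  by exists r%:num.
have r0 x : 0 < r x := (rP x).1.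
have : @cover_compact V K by rewrite -compact_cover.
case/(_ V K (fun x => [set y | 0 < ball_bump x (r x) y])).
- move=> x Kx; apply: (open_comp _ (@open_gt _ 0)) => y _.
  exact: (Ck_in_continuous (Ck_in_ball_bump 0 x (r x))).
- by move=> x Kx; exists x => //; exact: ball_bump_gt0.
move=> D' DK Kcov; pose D : seq V := finmap.enum_fset D'.
pose s (y : V) : R := \sum_(x <- D) ball_bump x (r x) y.
have cks k : Ck_in k s by apply: Ck_in_sum => x; exact: Ck_in_ball_bump.
have s_gt0 y : 0 < s y -> exists2 x, x \in D & 0 < ball_bump x (r x) y.
  move=> sy; apply/hasP; apply/negPn/negP => /hasPn h; move: sy.
  rewrite /s big_seq big1 ?ltxx // => x xD; apply/eqP.
  by rewrite eq_le flat1_ge0 andbT leNgt; exact: h.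
have Ks y : K y -> 0 < s y.
  move=> /Kcov[x /= xD bx]; rewrite /s (big_rem x) //=.
  by rewrite ltr_wpDr // sumr_ge0 // => z _; exact: flat1_ge0.
(* The factor 2 leaves room: [s > d] is an open condition that holds on all of [K]. *)
have [d d0 Kd] : exists2 d, 0 < d & forall y, K y -> 2 * d <= s y.
  have [->|K0] := eqVneq K set0; first by exists 1.
  have [||c /set_mem Kc cmin] := @compact_EVT_min _ _ s K _ cK.
  - exact/set0P.
  - by apply: continuous_subspaceT => y; exact: (Ck_in_continuous (cks 0%N)).
  exists (s c / 2) => [|y Ky]; first by rewrite divr_gt0 // Ks.
  by rewrite mulrC divfK // cmin // inE.
(* This is 0 where [s] vanishes and 1 where [s > d]; the denominator is positive since [s y] and
   [d - s y] cannot both be nonpositive. *)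
pose c y := (flat1 (s y) + flat1 (d - s y))^-1 *: flat1 (s y).
have den0 y : 0 < flat1 (s y) + flat1 (d - s y).
  have [sy|sy] := ltP 0 (s y).
    by rewrite ltr_pwDl ?flat1_gt0 // flat1_ge0.
  by rewrite ltr_wpDl ?flat1_ge0 // flat1_gt0 subr_gt0 (le_lt_trans sy).
pose C := \big[setU/set0]_(x <- D) closed_ball x (r x).
have cC : compact C by apply: bigsetU_compact => x _; exact: closed_ball_rV_compact.
have CO : C `<=` O.
  move=> y; rewrite /C -bigcup_seq => -[x /= xD].
  by apply: (rP x).2; apply: set_mem; exact: DK.
have cl : closure [set y | c y != 0] `<=` C.
  rewrite (closure_id C).1; last by apply: compact_closed => //; exact: norm_hausdorff.
  apply: closureS => y /= cy.
  have /s_gt0[x xD bx] : 0 < s y.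
    rewrite ltNge; apply: contra cy => sy.
    by rewrite /c (flat1_eq0 sy) scaler0.
  rewrite /C -bigcup_seq; exists x => //=.
  by apply: subset_closed_ball; exact: ball_bump_ball.
exists c; split.
- move=> k; apply: Ck_in_scale; last exact: Ck_in_flat1.
  apply: Ck_in_inv; first by move=> y; rewrite gt_eqF.
  apply: Ck_inD; first exact: Ck_in_flat1.
  apply: (@Ck_in_flat1 _ (fun y => d - s y)).
  under eq_fun do rewrite -mulN1r.
  by apply: Ck_in_sub => //; exact: Ck_in_cst.
- by apply: subclosed_compact cC cl; exact: closed_closure.
- exact: subset_trans cl CO.
- move=> y; rewrite /c /GRing.scale /= mulrC divr_ge0 ?flat1_ge0 ?(ltW (den0 y)) //=.
  by rewrite ler_pdivrMr // mul1r lerDl flat1_ge0.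
- exists [set y | d < s y]; split.
  + apply: (open_comp _ (@open_gt _ d)) => y _.
    exact: (Ck_in_continuous (cks 0%N)).
  + by move=> y /Kd; apply: lt_le_trans; rewrite mulr_natl mulr2n ltrDl.
  + move=> y /= dy; rewrite /c [flat1 (d - _)]flat1_eq0 ?subr_le0 ?ltW // addr0.
    by rewrite /GRing.scale /= mulVf // gt_eqF // flat1_gt0 (lt_trans d0).
Qed.

End smooth_urysohn.

(** * Test functions and total variation *)

Section test_fun_operations.
Context (R : realType) (n : nat) (U : set 'rV[R]_n).
Local Notation V := 'rV[R]_n.

Lemma rV_compact_closed (K : set V) : compact K -> closed K.
Proof. by apply: compact_closed; exact: norm_hausdorff. Qed.

Lemma spt_sub (K : set V) (f : V -> V) :
  closed K -> [set x | f x != 0] `<=` K -> spt f `<=` K.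
Proof. by move=> /closure_id cK fK; rewrite cK; exact: closureS. Qed.

Lemma spt_eq0 (f : V -> V) x : ~ spt f x -> f x = 0.
Proof.
by move=> h; apply/eqP/negPn/negP => fx; apply: h; exact: subset_closure.
Qed.

Lemma test_fun_eq (g h : test_fun U) : (g : V -> V) =1 h -> g = h.
Proof.
case: g h => [g sg cg gU] [h sh ch hU] /= /funext gh; subst h.
by congr TestFun; exact: Prop_irrelevance.
Qed.

Lemma test_fun_smooth (g : test_fun U) k : Ck_in k (g : V -> V).
Proof. by rewrite Ck_inE; exact: test_smooth. Qed.

Lemma test_fun_continuous (g : test_fun U) : continuous (g : V -> V).
Proof. exact: (@test_smooth _ _ _ g 0). Qed.

Section test_of.
Variables (f : V -> V) (K : set V).
Hypotheses (sf : forall k, Ck_in k f) (cK : compact K) (KU : K `<=` U)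
  (fK : [set x | f x != 0] `<=` K).

Let smooth k : Ck k f.
Proof. by rewrite -Ck_inE. Qed.

Let sptK : spt f `<=` K.
Proof. by apply: spt_sub => //; exact: rV_compact_closed. Qed.

Let cspt : compact (spt f).
Proof. by apply: subclosed_compact cK sptK; exact: closed_closure. Qed.

Definition test_of : test_fun U := TestFun smooth cspt (subset_trans sptK KU).

End test_of.

Section test_scale.
Variables (c : V -> R) (sc : forall k, Ck_in k c) (g : test_fun U).

Let scale_spt : [set x | c x *: g x != 0] `<=` spt g.
Proof.
by move=> x /=; apply: contraNP => /spt_eq0 ->; rewrite scaler0.
Qed.

Definition test_scale : test_fun U :=
  @test_of (fun x => c x *: g x) (spt g)
    (fun k => Ck_in_scale (sc k) (test_fun_smooth g k))
    (test_compact (t := g)) (test_sub (t := g)) scale_spt.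

Lemma spt_test_scale : spt test_scale `<=` spt g.
Proof. by apply: spt_sub => //; exact: closed_closure. Qed.

Lemma spt_test_scaleW : spt test_scale `<=` closure [set x | c x != 0].
Proof.
by apply: closureS => x /=; apply: contra => /eqP ->; rewrite scale0r.
Qed.

End test_scale.

Lemma Ck_in_onem (c : V -> R) : (forall k, Ck_in k c) ->
  forall k, Ck_in k (fun x => 1 + (-1) *: c x).
Proof. by move=> sc k; apply: Ck_in_sub => //; exact: Ck_in_cst. Qed.

(** This is why cutoffs are 1 on an open set and not merely on a compact one: the complement of [N]
    is closed, so the closure in [spt] does not reach back into [N]. *)
Lemma spt_test_scale_onem (c : V -> R) (sc : forall k, Ck_in k c)
    (g : test_fun U) (N : set V) : open N -> (forall x, N x -> c x = 1) ->
  spt (test_scale (Ck_in_onem sc) g) `<=` spt g `\` N.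
Proof.
move=> oN c1; apply: spt_sub => [|x /= cg].
  by apply: closedI; [exact: closed_closure|exact: open_closedC].
split; first by apply: contrapT => /spt_eq0 gx; rewrite gx scaler0 eqxx in cg.
by move=> /c1 cx; rewrite cx scaleN1r subrr scale0r eqxx in cg.
Qed.

Lemma enorm_scale_le (a r : R) (x : V) : `|a| <= 1 -> enorm x <= r ->
  enorm (a *: x) <= r.
Proof. by move=> a1; apply: le_trans; rewrite enormZ ler_piMl ?enorm_ge0. Qed.

Lemma norm_unit_itv (a : R) : 0 <= a <= 1 -> `|a| <= 1 /\ `|1 + (-1) *: a| <= 1.
Proof.
by move=> /andP[a0 a1]; rewrite scaleN1r !ler_norml; split; apply/andP; split; lra.
Qed.

Definition test_mulr (a : R) (g : test_fun U) : test_fun U :=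
  test_scale (fun k => Ck_in_cst n k a) g.

Section test_add.
Variables (g h : test_fun U).

Let add_spt : [set x | g x + h x != 0] `<=` spt g `|` spt h.
Proof.
move=> x /=; apply: contraNP => /not_orP[/spt_eq0 -> /spt_eq0 ->].
by rewrite addr0.
Qed.

Let add_sub : spt g `|` spt h `<=` U.
Proof. by move=> x [|]; exact: test_sub. Qed.

Definition test_add : test_fun U :=
  @test_of (fun x => g x + h x) (spt g `|` spt h)
    (fun k => Ck_inD (test_fun_smooth g k) (test_fun_smooth h k))
    (compactU (test_compact (t := g)) (test_compact (t := h))) add_sub add_spt.

Lemma spt_test_add : spt test_add `<=` spt g `|` spt h.
Proof. by apply: spt_sub => //; apply: closedU; exact: closed_closure. Qed.

End test_add.

Definition test_linear (T : test_fun U -> R) :=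
  (forall g h, T (test_add g h) = T g + T h) /\
  (forall a g, T (test_mulr a g) = a * T g).

Definition test0 : test_fun U :=
  @test_of (fun=> 0) set0 (fun k => Ck_in_cst n k (0 : V)) (@compact0 _)
    (@sub0set _ U) (fun x h => False_ind _ (negP h (eqxx 0))).

Lemma spt_test0 : spt test0 = set0.
Proof. by rewrite -subset0; apply: spt_sub => [|x /= /negP]; [exact: closed0|apply]. Qed.

End test_fun_operations.

(** * Total variation as an outer measure *)

Section total_variation.
Context (R : realType) (n : nat) (U : set 'rV[R]_n).
Local Notation V := 'rV[R]_n.
Local Open Scope ereal_scope.

Definition variation_on (T : test_fun U -> R) (G : set V) : \bar R :=
  ereal_sup [set (T g)%:E | g in
    [set g : test_fun U | spt g `<=` G /\ forall x, (enorm (g x) <= 1)%R]].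

(** Only the part of [A] inside [U] has to be covered, which makes the complement of [U] a null
    set. *)
Definition variation_outer (T : test_fun U -> R) (A : set V) : \bar R :=
  ereal_inf [set variation_on T G | G in
    [set G | [/\ open G, G `<=` U & A `&` U `<=` G]]].

Section linear_functional.
Variables (T : test_fun U -> R) (linT : test_linear T).
Local Notation lam := (variation_on T).
Local Notation tv := (variation_outer T).

Lemma test_linear0 (g : test_fun U) : (forall x, g x = 0%R) -> T g = 0%R.
Proof.
move=> g0; rewrite -(_ : test_mulr 0 g = g); first by rewrite linT.2 mul0r.
by apply: test_fun_eq => x /=; rewrite scale0r g0.
Qed.

Lemma variation_on_ge (g : test_fun U) (G : set V) : spt g `<=` G ->
  (forall x, enorm (g x) <= 1)%R -> (T g)%:E <= lam G.
Proof. by move=> gG g1; apply: ereal_sup_ubound; exists g. Qed.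

Lemma le_variation_on (G H : set V) : G `<=` H -> lam G <= lam H.
Proof.
move=> GH; apply: ereal_sup_le => _ [g [gG g1] <-].
by exists g => //; split=> //; exact: subset_trans GH.
Qed.

Lemma variation_on_ge0 G : 0 <= lam G.
Proof.
rewrite -[leLHS]/(0%R%:E) -(@test_linear0 (test0 U)) //.
apply: variation_on_ge; first by rewrite spt_test0.
by move=> x /=; rewrite enorm0.
Qed.

Lemma variation_on0 : lam set0 = 0.
Proof.
apply/eqP; rewrite eq_le variation_on_ge0 andbT; apply: ge_ereal_sup.
move=> _ [g [g0 _] <-]; rewrite test_linear0 // => x.
by apply: spt_eq0 => /g0.
Qed.

Lemma variation_on_scale (a : R) (g : test_fun U) (G : set V) : (0 <= a)%R ->
  spt g `<=` G -> (forall x, enorm (g x) <= a)%R -> (T g)%:E <= a%:E * lam G.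
Proof.
rewrite le_eqVlt => /orP[/eqP<- _ g0|a0 gG ga].
  rewrite mul0e test_linear0 // => x; apply/eqP.
  by rewrite -enorm_eq0 eq_le enorm_ge0 g0.
rewrite -lee_pdivrMl // -EFinM -linT.2; apply: variation_on_ge.
  exact: subset_trans (@spt_test_scale _ _ _ _ _ _) gG.
move=> x /=; rewrite enormZ ger0_norm ?invr_ge0 ?(ltW a0) //.
by rewrite ler_pdivrMl // mulr1.
Qed.

(** Fields with disjoint supports can be added without leaving the unit ball. This superadditivity
    is the source of the measurability of open sets. *)
Lemma variation_on_setD (g : test_fun U) (G : set V) : spt g `<=` G ->
  (forall x, enorm (g x) <= 1)%R -> (T g)%:E + lam (G `\` spt g) <= lam G.
Proof.
move=> gG g1; rewrite -leeBrDl //; apply: ge_ereal_sup => _ [h [hG h1] <-].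
rewrite leeBrDl // -EFinD -linT.1; apply: variation_on_ge.
  by move=> x /spt_test_add[/gG //|/hG[]].
move=> x /=; have [gx|/spt_eq0 ->] := pselect (spt g x); last by rewrite add0r.
by rewrite (@spt_eq0 _ _ h) ?addr0 // => /hG[].
Qed.

(* A smooth cutoff equal to 1 near [spt g `\` H] splits [g] along [G] and [H]. *)
Lemma variation_onU (G H : set V) : open G -> open H ->
  lam (G `|` H) <= lam G + lam H.
Proof.
move=> oG oH; apply: ge_ereal_sup => _ [g [gGH g1] <-].
have cK : compact (spt g `\` H).
  apply: compact_closedI; first exact: test_compact.
  exact: open_closedC.
have KG : spt g `\` H `<=` G by move=> x [/gGH[]].
have [c [sc _ cG c01 [N [oN KN c1]]]] := smooth_urysohn cK oG KG.
have -> : g = test_add (test_scale sc g) (test_scale (Ck_in_onem sc) g).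
  by apply: test_fun_eq => x /=; rewrite -scalerDl scaleN1r addrC subrK scale1r.
rewrite linT.1 EFinD leeD //; apply: variation_on_ge => /=.
- exact: subset_trans (@spt_test_scaleW _ _ _ _ _ _) cG.
- by move=> x; apply: enorm_scale_le => //; have [] := norm_unit_itv (c01 x).
- apply: (@subset_trans _ (spt g `\` N)); first exact: spt_test_scale_onem.
  move=> x [gx Nx].
  by apply: contrapT => Hx; apply: Nx; exact: KN.
- by move=> x; apply: enorm_scale_le => //; have [] := norm_unit_itv (c01 x).
Qed.

(** A competitor has compact support, so finitely many of the [G k] cover it and finite
    subadditivity suffices. *)
Lemma variation_on_bigcup (G : (set V)^nat) : (forall k, open (G k)) ->
  lam (\bigcup_k G k) <= \sum_(k <oo) lam (G k).
Proof.
move=> oG; apply: ge_ereal_sup => _ [g [gG g1] <-].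
have : @cover_compact V (spt g) by rewrite -compact_cover; exact: test_compact.
case/(_ nat setT G) => // D _ gD.
pose N := (\max_(k <- finmap.enum_fset D) k).+1.
have finU m : lam (\big[setU/set0]_(k < m) G k) <= \sum_(k < m) lam (G k).
  elim: m => [|m IH]; first by rewrite !big_ord0 variation_on0.
  rewrite !big_ord_recr /=; apply: (le_trans (variation_onU _ (oG m))).
    by apply: (big_ind open) => [|A B|i _]; [exact: open0|exact: openU|exact: oG].
  by apply: leeD2r.
apply: (@le_trans _ _ (lam (\big[setU/set0]_(k < N) G k))).
  apply: variation_on_ge => // x /gD[k /= kD Gx].
  rewrite -(bigcup_mkord N G); exists k => //=.
  by rewrite ltnS; apply: (@leq_bigmax_seq _ _ xpredT id).
apply: (le_trans (finU N)).
rewrite -(big_mkord xpredT (fun k => lam (G k))).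
by apply: nneseries_lim_ge => k _ _; exact: variation_on_ge0.
Qed.

Lemma variation_outer_le (A G : set V) : open G -> G `<=` U -> A `&` U `<=` G ->
  tv A <= lam G.
Proof. by move=> oG GU AG; apply: ereal_inf_lbound; exists G. Qed.

Lemma variation_outer_ge0 A : 0 <= tv A.
Proof. by apply: le_ereal_inf_tmp => _ [G _ <-]; exact: variation_on_ge0. Qed.

Lemma variation_outer_open (G : set V) : open G -> G `<=` U -> tv G = lam G.
Proof.
move=> oG GU; apply/eqP; rewrite eq_le; apply/andP; split.
  by apply: variation_outer_le => // x [].
apply: le_ereal_inf_tmp => _ [H [oH HU GH] <-].
by apply: le_variation_on => x Gx; apply: GH; split=> //; exact: GU.
Qed.

Lemma variation_outer_adherent (A : set V) (e : R) : (0 < e)%R -> tv A < +oo ->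
  exists G, [/\ open G, G `<=` U, A `&` U `<=` G & lam G <= tv A + e%:E].
Proof.
move=> e0 Afin; have fA : tv A \is a fin_num.
  by rewrite ge0_fin_numE // variation_outer_ge0.
have [_ [G [oG GU AG] <-] lG] := lb_ereal_inf_adherent e0 fA.
by exists G; split=> //; exact: ltW.
Qed.

Lemma variation_outer_set0 : tv set0 = 0.
Proof.
by rewrite variation_outer_open ?variation_on0 //; exact: open0.
Qed.

Lemma le_variation_outer (A B : set V) : A `<=` B -> tv A <= tv B.
Proof.
move=> AB; apply: ereal_inf_le_tmp => _ [G [oG GU BG] <-].
by exists G => //; split=> //; apply: subset_trans BG; exact: setSI.
Qed.

Lemma variation_outer_sigma_subadditive : sigma_subadditive tv.
Proof.
move=> A; have [[i ioo]|] := pselect (exists i, tv (A i) = +oo).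
  rewrite (eseries_pinfty _ _ ioo) ?leey// => k _.
  by rewrite -ltNye (lt_le_trans _ (variation_outer_ge0 _)).
rewrite -forallNE => Aoo.
apply/lee_addgt0Pr => e e0.
apply: le_trans (epsilon_trick _ _ (ltW e0)); last first.
  by move=> k; exact: variation_outer_ge0.
have /choice[G GP] k : exists G, [/\ open G, G `<=` U, A k `&` U `<=` G &
    lam G <= tv (A k) + (e / (2 ^ k.+1)%:R)%:E].
  apply: variation_outer_adherent; first by rewrite divr_gt0 // ltr0n expn_gt0.
  by rewrite ltey; apply/eqP; exact: Aoo.
apply: (@le_trans _ _ (lam (\bigcup_k G k))).
  apply: variation_outer_le.
  - by apply: bigcup_open => k _; have [] := GP k.
  - by move=> x [k _]; have [_ + _ _] := GP k; apply.
  - by move=> x [[k _ Ax] Ux]; exists k => //; have [_ _ + _] := GP k; apply.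
apply: (le_trans (variation_on_bigcup _)) => [k|]; first by have [] := GP k.
apply: lee_nneseries => [k _ _|k _]; first exact: variation_on_ge0.
by have [] := GP k.
Qed.

End linear_functional.

(** The proof [linT] is an argument because the outer measure structure declared next is built from
    it. *)
Definition variation_measure_fun (T : test_fun U -> R) (linT : test_linear T) :=
  variation_outer T.

HB.instance Definition _ (T : test_fun U -> R) (linT : test_linear T) :=
  isOuterMeasure.Build R V (variation_measure_fun linT)
    (variation_outer_set0 linT) (variation_outer_ge0 linT)
    (@le_variation_outer T) (variation_outer_sigma_subadditive linT).

Definition variation_measure (T : test_fun U -> R) (linT : test_linear T) :
  {outer_measure set V -> \bar R} := variation_measure_fun linT.

End total_variation.

Section regularity.
Context (R : realType) (T : topologicalType).
Implicit Types (X A B : set T) (mu : {outer_measure set T -> \bar R}).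
Local Open Scope ereal_scope.

(** The last clause of [radon_over], isolated because it is what determines a measure by its values
    on relatively open sets. *)
Definition outer_regular_over X mu := forall A, A `<=` X ->
  mu A = ereal_inf [set mu G | G in [set G | relopen X G /\ A `<=` G]].

Lemma relopen_sub X G : relopen X G -> G `<=` X.
Proof. by move=> [G0 _ <-]; exact: subIsetr. Qed.

Lemma relopenT X : relopen X X.
Proof. by exists setT; [exact: openT|rewrite setTI]. Qed.

Lemma relopenI X G H : relopen X G -> relopen X H -> relopen X (G `&` H).
Proof.
move=> [G0 oG <-] [H0 oH <-]; exists (G0 `&` H0); first exact: openI.
by rewrite setIACA setIid.
Qed.

Lemma relopenU X G H : relopen X G -> relopen X H -> relopen X (G `|` H).
Proof.
move=> [G0 oG <-] [H0 oH <-]; exists (G0 `|` H0); first exact: openU.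
by rewrite setIUl.
Qed.

Lemma relopen_bigcup X (G : (set T)^nat) :
  (forall k, relopen X (G k)) -> relopen X (\bigcup_k G k).
Proof.
move=> rG.
have /choice[G0 GP] k : exists G0, open G0 /\ G0 `&` X = G k.
  by have [G0 oG0 G0k] := rG k; exists G0.
exists (\bigcup_k G0 k).
  by apply: bigcup_open => k _; have [] := GP k.
by rewrite setI_bigcupl; apply: eq_bigcupr => k _; have [] := GP k.
Qed.

Lemma relopen_openE X G : open X -> relopen X G <-> open G /\ G `<=` X.
Proof.
move=> oX; split=> [[G0 oG <-]|[oG GX]]; last by exists G => //; exact/setIidPl.
by split; [exact: openI|exact: subIsetr].
Qed.

Lemma outer_measure_null X mu A : mu (~` X) = 0 -> mu (A `&` X) = mu A.
Proof.
move=> X0; apply/eqP; rewrite eq_le le_outer_measure /=; last exact: subIsetl.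
apply: le_trans (le_outer_measureIC mu X A) _; rewrite geeDl //.
by rewrite -X0 le_outer_measure //; exact: subIsetr.
Qed.

Lemma null_caratheodory mu A : mu A = 0 -> mu.-caratheodory A.
Proof.
move=> A0; apply: le_caratheodory_measurable => X.
suff -> : mu (X `&` A) = 0 by rewrite add0e; apply: le_outer_measure; exact: subIsetl.
apply/eqP; rewrite eq_le outer_measure_ge0 andbT -A0.
by apply: le_outer_measure; exact: subIsetr.
Qed.

Lemma open_caratheodory X mu G : mu (~` X) = 0 ->
  (forall G, relopen X G -> mu.-caratheodory G) -> open G -> mu.-caratheodory G.
Proof.
move=> X0 mX oG; rewrite -(setUIDK G X).
apply: caratheodory_measurable_setU; first by apply: mX; exists G.
apply: null_caratheodory; apply/eqP; rewrite eq_le outer_measure_ge0 andbT.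
by rewrite -X0 le_outer_measure //; exact: subIsetr.
Qed.

Lemma outer_regular_adherent X mu A (e : R) : outer_regular_over X mu ->
  A `<=` X -> (0 < e)%R -> mu A < +oo ->
  exists G, [/\ relopen X G, A `<=` G & mu G <= mu A + e%:E].
Proof.
move=> rX AX e0 Afin; have fA : mu A \is a fin_num.
  by rewrite ge0_fin_numE // outer_measure_ge0.
move: (fA); rewrite {1}(rX _ AX) => /(lb_ereal_inf_adherent e0).
rewrite -(rX _ AX) => -[_ [G [rG AG] <-] lG].
by exists G; split=> //; exact: ltW.
Qed.

Lemma sigma_algebra_bigcap_over X (G : set (set T)) (F : (set T)^nat) :
  (forall k, <<s X, G >> (F k)) -> (forall k, F k `<=` X) ->
  <<s X, G >> (\bigcap_k F k).
Proof.
move=> GF FX; have [s0 sD sU] := smallest_sigma_algebra X G.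
rewrite (_ : \bigcap_k F k = X `\` \bigcup_k (X `\` F k)).
  by apply: (sD); apply: sU => k; exact: sD.
apply/seteqP; split=> [x Fx|x [Xx Fx] k _].
  by split=> [|[k _ [_]]]; [exact: (FX 0%N) (Fx 0%N I)|apply; exact: Fx].
by apply: contrapT => Fkx; apply: Fx; exists k.
Qed.

(** A set of finite measure has a hull that is a countable intersection of relatively open sets; for
    infinite measure [X] itself is a hull. *)
Lemma outer_regular_borel X mu : mu (~` X) = 0 ->
  (forall G, relopen X G -> mu.-caratheodory G) -> outer_regular_over X mu ->
  borel_regular_over X mu.
Proof.
move=> X0 mX rX; split=> // A AX.
have sub G : relopen X G -> <<s X, relopen X >> G by exact: sub_gen_smallest.
have [Afin|] := ltP (mu A) +oo; last first.
  rewrite leye_eq => /eqP Ay; exists X; split=> //; first exact: sub (relopenT X).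
  by apply/eqP; rewrite Ay -leye_eq -Ay le_outer_measure.
have /choice[G GP] (k : nat) : exists G, [/\ relopen X G, A `<=` G &
    mu G <= mu A + (k.+1%:R^-1)%:E].
  by apply: outer_regular_adherent => //; rewrite invr_gt0.
exists (\bigcap_k G k); split.
- apply: sigma_algebra_bigcap_over => k; first by apply: sub; have [] := GP k.
  by have [/relopen_sub] := GP k.
- by move=> x Ax k _; have [_ + _] := GP k; apply.
- apply/eqP; rewrite eq_le; apply/andP; split; last first.
    by apply: le_outer_measure => x Ax k _; have [_ + _] := GP k; apply.
  apply/lee_addgt0Pr => e e0.
  have [k ke] : exists k : nat, (k.+1%:R^-1 <= e)%R.
    exists (Num.trunc e^-1); rewrite -[leRHS]invrK lef_pV2 ?posrE ?invr_gt0 //.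
    by apply: ltW; rewrite truncnS_gt.
  apply: (@le_trans _ _ (mu (G k))); first by apply: le_outer_measure; exact: bigcap_inf.
  by have [_ _] := GP k; move=> /le_trans; apply; rewrite leeD2l // lee_fin.
Qed.

End regularity.

(** * Identification of the largest measure *)

Section dist_variation_characterization.
Context (R : realType) (n : nat) (U : set 'rV[R]_n) (oU : open U).
Local Notation V := 'rV[R]_n.
Local Open Scope ereal_scope.
Implicit Types (T : test_fun U -> R) (mu : {outer_measure set V -> \bar R}).

(** All members of the class agree on open subsets of [U], and outer regularity computes [mu A] from
    those values; so [mu] is the largest member and [the_measure] does not return its default. *)
Lemma dist_variationE T mu : dist_variation_class T mu ->
  outer_regular_over U mu -> forall A, dist_variation T A = mu A.
Proof.
move=> Tmu rmu.
have le_mu nu : dist_variation_class T nu -> forall A, nu A <= mu A.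
  move=> Tnu A; have [[nu0 _ _] nuT] := Tnu; have [[mu0 _ _] muT] := Tmu.
  rewrite -(outer_measure_null A nu0) -(outer_measure_null A mu0).
  rewrite (rmu (A `&` U)); last exact: subIsetr.
  apply: le_ereal_inf_tmp => _ [G [/(relopen_openE _ oU)[oG GU] AG] <-].
  by apply: (le_trans (le_outer_measure nu _ _ AG)); rewrite nuT // muT.
move=> A; rewrite /dist_variation /the_measure; case: pselect => [h|]; last first.
  by case; exists mu.
case: cid => nu [nuT nuL] /=.
by apply/eqP; rewrite eq_le le_mu //= nuL.
Qed.

Lemma variation_measure_outer_regular T (linT : test_linear T) :
  outer_regular_over U (variation_measure linT).
Proof.
move=> A AU; congr ereal_inf; apply/seteqP; split=> y [G].
  move=> [oG GU AG] <-; exists G.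
    by split; [exact/relopen_openE|move=> x Ax; apply: AG; split=> //; exact: AU].
  by apply: variation_outer_open.
move=> [/(relopen_openE _ oU)[oG GU] AG] <-; exists G.
  by split=> // x [/AG].
by rewrite -variation_outer_open.
Qed.

(** An open [G] is measurable: if [O] covers [X] and [g] is supported in [O] and [G], then [O] minus
    the support of [g] still covers [X] off [G], and [variation_on_setD] bounds the two
    contributions by the variation on [O]. *)
Lemma variation_measure_class T (linT : test_linear T) :
  dist_variation_class T (variation_measure linT).
Proof.
split; last by move=> G oG GU; apply: variation_outer_open.
apply: outer_regular_borel; last exact: variation_measure_outer_regular.
  apply/eqP; rewrite eq_le outer_measure_ge0 andbT -(variation_on0 linT).
  apply: variation_outer_le; [exact: open0|exact: sub0set|by rewrite setICl].
move=> G /(relopen_openE _ oU)[oG GU].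
apply: le_caratheodory_measurable => X.
apply: le_ereal_inf_tmp => _ [ O [oO OU XO] <-].
have [Ofin|] := ltP (variation_on T O) +oo; last first.
  by rewrite leye_eq => /eqP ->; rewrite leey.
have XGO : variation_outer T (X `&` ~` G) <= variation_on T O.
  by apply: variation_outer_le => // x [[Xx _] Ux]; apply: XO.
have fXG : variation_outer T (X `&` ~` G) \is a fin_num.
  by rewrite ge0_fin_numE ?variation_outer_ge0 // (le_lt_trans XGO).
have XG : variation_outer T (X `&` G) <= variation_on T (O `&` G).
  apply: variation_outer_le; [exact: openI|by move=> x [/OU]|].
  by move=> x [[Xx Gx] Ux]; split=> //; exact: XO.
apply: le_trans (leeD2r _ XG) _.
rewrite -leeBrDr //; apply: ge_ereal_sup => _ [g [gO g1] <-].
rewrite leeBrDr //.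
apply: le_trans (variation_on_setD linT (_ : spt g `<=` O) g1); last first.
  by move=> x /gO[].
rewrite leeD2l //; apply: variation_outer_le.
- by rewrite setDE; apply: openI => //; apply: closed_openC; exact: closed_closure.
- by move=> x [/OU].
- move=> x [[Xx Gx] Ux]; split; first exact: XO.
  by move=> /gO[].
Qed.

Lemma dist_variation_outer T (linT : test_linear T) A :
  dist_variation T A = variation_outer T A.
Proof.
exact: (dist_variationE (variation_measure_class linT)
  (variation_measure_outer_regular linT)).
Qed.

End dist_variation_characterization.

(** * Restriction of Radon measures *)

HB.instance Definition _ (A B : ptopologicalType) := Pointed.on (A * B)%type.

Section radon_restriction.
Context (R : realType) (T : ptopologicalType).
Hypothesis hT : hausdorff_space T.
Implicit Types (A B G H K Z : set T).
Local Open Scope ereal_scope.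

(** Sigma-finiteness by increasing relatively open sets: approximation up to [e] is meaningful only
    where the measure is finite. *)
Definition open_exhaustion (X : set T) (mu : set T -> \bar R) (Y : (set T)^nat) :=
  [/\ forall k, relopen X (Y k), forall k, mu (Y k) < +oo,
      nondecreasing_seq Y & X `<=` \bigcup_k Y k].

Variables (X : set T) (mu : {outer_measure set T -> \bar R}) (Y : (set T)^nat).
Hypotheses (rmu : radon_over X mu) (exY : open_exhaustion X mu Y).

Lemma radon_open_caratheodory G : open G -> mu.-caratheodory G.
Proof. by have [X0 _ mX _ _] := rmu; apply: open_caratheodory X0 mX. Qed.

Lemma radon_closed_caratheodory K : closed K -> mu.-caratheodory K.
Proof.
move=> cK; rewrite -[K]setCK; apply: caratheodory_measurable_setC.
by apply: radon_open_caratheodory; exact: closed_openC.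
Qed.

Lemma nondecreasing_caratheodory_le (F : (set T)^nat) A (M : \bar R) :
  (forall k, mu.-caratheodory (F k)) -> nondecreasing_seq F ->
  A `<=` \bigcup_k F k -> (forall k, mu (F k) <= M) -> mu A <= M.
Proof.
move=> mF ndF AF FM; apply: le_trans (le_outer_measure mu _ _ AF) _.
have mF' k : measurable (F k : set (caratheodory_type mu)) := mF k.
have mU : measurable (\bigcup_k F k : set (caratheodory_type mu)).
  exact: bigcup_measurable.
have cv := @nondecreasing_cvg_mu _ (caratheodory_type mu) R
  (mu : set (caratheodory_type mu) -> \bar R) F mF' mU ndF.
rewrite -(cvg_lim _ cv) //; apply: lime_le; first by apply/cvg_ex; eexists; exact: cv.
by apply: nearW => k; exact: FM.
Qed.

Lemma orestr_caratheodory Z A : mu.-caratheodory A ->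
  (orestr mu Z).-caratheodory A.
Proof. by move=> mA B; rewrite /orestr (mA (B `&` Z)) !(setIAC _ Z). Qed.

Section measurable_set.
Variables (Z : set T) (mZ : mu.-caratheodory Z).

(** One set [H] serves both regularity properties of the restriction to [Z]: added to an open set it
    covers what lies outside [Z] at cost [e], and removed from a compact set it leaves a compact
    part of [Z]. *)
Lemma radon_complement_adherent (e : R) : (0 < e)%R ->
  exists H, [/\ relopen X H, X `\` Z `<=` H & mu (H `&` Z) <= e%:E].
Proof.
move=> e0; have [Yo Yfin _ XY] := exY; have [_ _ mX _ rX] := rmu.
have /choice[H HP] k : exists H, [/\ relopen X H, Y k `\` Z `<=` H &
    mu (H `&` Z) <= (e / (2 ^ k.+1)%:R)%:E].
  have ek : (0 < e / (2 ^ k.+1)%:R)%R by rewrite divr_gt0 // ltr0n expn_gt0.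
  have YZX : Y k `\` Z `<=` X by move=> x [/(relopen_sub (Yo k))].
  have YZfin : mu (Y k `\` Z) < +oo.
    by apply: le_lt_trans (Yfin k); apply: le_outer_measure; exact: subDsetl.
  have [H [oH YH lH]] := outer_regular_adherent rX YZX ek YZfin.
  exists H; split=> //.
  have fYZ : mu (Y k `\` Z) \is a fin_num by rewrite ge0_fin_numE ?outer_measure_ge0.
  (* As [Z] is measurable, [H] splits along it, and its part off [Z] contains [Y k] minus [Z], whose
     finite measure cancels. *)
  rewrite -(leeD2rE _ _ fYZ) [leRHS]addeC; apply: le_trans lH.
  rewrite (mZ H) leeD2l // le_outer_measure // => x Yx; split; [exact: YH|].
  by case: Yx.
exists (\bigcup_k H k); split.
- by apply: relopen_bigcup => k; have [] := HP k.
- move=> x [Xx Zx]; have [k _ Yx] := XY x Xx.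
  by exists k => //; have [_ + _] := HP k; apply.
- rewrite setI_bigcupl; apply: le_trans (outer_measure_sigma_subadditive mu _) _.
  apply: (@le_trans _ _ (\sum_(k <oo) (0 + (e / (2 ^ k.+1)%:R)%:E))).
    apply: lee_nneseries => [k _ _|k _]; first exact: outer_measure_ge0.
    by rewrite add0e; have [] := HP k.
  apply: le_trans (epsilon_trick _ _ (ltW e0)) _ => //.
  by rewrite eseries0 // add0e.
Qed.

Lemma orestr_outer_regular : outer_regular_over X (orestr mu Z).
Proof.
have [_ _ mX _ rX] := rmu.
move=> A AX; apply/eqP; rewrite eq_le; apply/andP; split.
  apply: le_ereal_inf_tmp => _ [G [_ AG] <-].
  exact: le_outer_measure.
have [Afin|] := ltP (mu (A `&` Z)) +oo; last first.
  by rewrite leye_eq => /eqP h; rewrite [leRHS]h leey.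
apply/lee_addgt0Pr => e e0.
have e20 : (0 < e / 2)%R by rewrite divr_gt0.
have AZX : A `&` Z `<=` X by move=> x [/AX].
have [G [oG AG lG]] := outer_regular_adherent rX AZX e20 Afin.
have [H [oH XH lH]] := radon_complement_adherent e20.
apply: (@le_trans _ _ (orestr mu Z (G `|` H))).
  apply: ereal_inf_lbound; exists (G `|` H) => //; split; first exact: relopenU.
  move=> x Ax; have [Zx|Zx] := pselect (Z x); first by left; apply: AG.
  by right; apply: XH; split=> //; exact: AX.
rewrite /orestr setIUl; apply: le_trans (outer_measureU2 _ _ _) _.
rewrite [e in leRHS]splitr EFinD addeA; apply: leeD lH.
by apply: le_trans lG; apply: le_outer_measure; exact: subIsetl.
Qed.

Lemma radon_inner_approx G (e : R) : (0 < e)%R -> relopen X G -> mu G < +oo ->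
  exists K, [/\ compact K, K `<=` G `&` Z & mu (G `&` Z `\` K) <= e%:E].
Proof.
move=> e0 oG Gfin; have [_ _ mX iX _] := rmu.
have e20 : (0 < e / 2)%R by rewrite divr_gt0.
have [H [oH XH lH]] := radon_complement_adherent e20.
have fG : mu G \is a fin_num by rewrite ge0_fin_numE ?outer_measure_ge0.
have [K [cK KG] lK] : exists2 K, compact K /\ K `<=` G & mu G - (e / 2)%:E < mu K.
  have := fG; rewrite {1}(iX _ oG) => /(ub_ereal_sup_adherent e20).
  by rewrite -(iX _ oG) => -[_ [K KP <-] lK]; exists K.
have [H0 oH0 HE] := oH.
(* [H0] is open in the whole space, unlike its trace [H] on [X], so removing it from [K] leaves a
   compact set. *)
exists (K `&` ~` H0); split.
- by apply: compact_closedI => //; exact: open_closedC.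
- move=> x [Kx Hx]; split; first exact: KG.
  apply: contrapT => Zx; apply: Hx.
  have : H x by apply: XH; split=> //; exact: (relopen_sub oG) (KG _ Kx).
  by rewrite -HE => -[].
apply: (@le_trans _ _ (mu ((G `\` K) `|` (H `&` Z)))).
  apply: le_outer_measure => x [[Gx Zx] KHx].
  have [Kx|Kx] := pselect (K x); last by left.
  right; split=> //; rewrite -HE; split; last exact: (relopen_sub oG).
  by apply: contrapT => H0x; exact: KHx.
apply: le_trans (outer_measureU2 _ _ _) _.
rewrite (splitr e) EFinD; apply: leeD lH.
have mK : mu.-caratheodory K by apply: radon_closed_caratheodory; exact: compact_closed.
have GK : G `&` K = K by apply/setIidPr.
have fK : mu K \is a fin_num.
  rewrite ge0_fin_numE ?outer_measure_ge0 //; apply: le_lt_trans Gfin.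
  exact: le_outer_measure.
rewrite -(leeD2lE _ _ fK) -{1}GK -(mK G) -leeBlDr //; exact: ltW.
Qed.

(** Since [mu G] may be infinite, compact sets are found inside the pieces of [G] in [Y k], and
    continuity from below passes to [G]. *)
Lemma orestr_inner_regular G : relopen X G ->
  orestr mu Z G =
  ereal_sup [set orestr mu Z K | K in [set K | compact K /\ K `<=` G]].
Proof.
move=> oG; have [Yo Yfin Ynd XY] := exY; have [_ _ mX _ _] := rmu.
apply/eqP; rewrite eq_le; apply/andP; split; last first.
  apply: ge_ereal_sup => _ [K [_ KG] <-].
  exact: le_outer_measure.
apply: (@nondecreasing_caratheodory_le (fun k => (G `&` Y k) `&` Z)).
- by move=> k; apply: caratheodory_measurable_setI => //; apply: mX; exact: relopenI.
- move=> i j ij; apply/subsetPset; apply: setSI; apply: setIS.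
  by apply/subsetPset; exact: Ynd.
- move=> x [Gx Zx]; have [k _ Yx] := XY x (relopen_sub oG Gx).
  by exists k.
- move=> k; apply/lee_addgt0Pr => e e0.
  have GYfin : mu (G `&` Y k) < +oo.
    by apply: le_lt_trans (Yfin k); apply: le_outer_measure; exact: subIsetr.
  have [K [cK KG lK]] := radon_inner_approx e0 (relopenI oG (Yo k)) GYfin.
  have KZ : K `&` Z = K by apply/setIidPl => x /KG[].
  apply: (@le_trans _ _ (mu (K `|` ((G `&` Y k `&` Z) `\` K)))).
    by apply: le_outer_measure => x GYx; have [Kx|Kx] := pselect (K x); [left|right].
  apply: le_trans (outer_measureU2 _ _ _) _; apply: leeD lK.
  apply: ereal_sup_ubound; exists K; last by rewrite /orestr KZ.
  by split=> // x /KG[[]].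
Qed.

Lemma orestr_radon : radon_over X (orestr mu Z).
Proof.
have [X0 Kfin mX _ _] := rmu; split.
- apply/eqP; rewrite eq_le outer_measure_ge0 andbT -X0.
  by apply: le_outer_measure; exact: subIsetl.
- move=> K cK KX; apply: le_lt_trans (Kfin _ cK KX).
  by apply: le_outer_measure; exact: subIsetl.
- by move=> G /mX; exact: orestr_caratheodory.
- exact: orestr_inner_regular.
- exact: orestr_outer_regular.
Qed.

End measurable_set.
End radon_restriction.

(** * The Grassmannian *)

Section orthproj_theory.
Context (R : realType) (n : nat).
Local Notation V := 'rV[R]_n.
Implicit Types (S : {vspace V}) (P : 'M[R]_n).

Lemma mulmx_rV_eq (m : nat) (A B : 'M[R]_(n, m)) : (forall v : V, v *m A = v *m B) -> A = B.
Proof. by move=> AB; apply/row_matrixP => i; rewrite !rowE. Qed.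

Lemma rV_self_orth (u : V) : u *m u^T = 0 -> u = 0.
Proof.
move=> /matrixP/(_ 0 0); rewrite !mxE => u0.
apply/eqP; rewrite -enorm_eq0 -sqrf_eq0 enorm_sqr -[X in _ == X]u0; apply/eqP.
by apply: eq_bigr => i _; rewrite mxE expr2.
Qed.

Lemma orthproj_id S (w : V) : w \in S -> w *m orthproj S = w.
Proof.
move=> wS; have [PS Porth] := orthprojP S w.
have rS : w - w *m orthproj S \in S by exact: memvB.
by apply/esym/eqP; rewrite -subr_eq0; apply/eqP/rV_self_orth/Porth.
Qed.

Lemma mem_orthproj S (w : V) : (w \in S) = (w *m orthproj S == w).
Proof.
by apply/idP/eqP => [|<-]; [exact: orthproj_id|have [] := orthprojP S w].
Qed.

Lemma orthproj_idem S : orthproj S *m orthproj S = orthproj S.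
Proof.
apply: mulmx_rV_eq => v; rewrite mulmxA orthproj_id //.
by have [] := orthprojP S v.
Qed.

Lemma orthproj_sym S : (orthproj S)^T = orthproj S.
Proof.
set P := orthproj S.
(* Entry by entry, this is the orthogonality of [e_i - e_i P] to [e_j P] for basis vectors. The
   right-hand side is symmetric, hence so is [P]. *)
have PE : P^T = P *m P^T.
  apply/eqP; rewrite -subr_eq0; apply/eqP/matrixP => i j.
  have [_ h] := orthprojP S (delta_mx 0 i).
  have [h' _] := orthprojP S (delta_mx 0 j).
  have := h _ h'; rewrite -/P trmx_mul trmx_delta mulmxA mulmxBl -mulmxA -mulmxBr.
  by rewrite -rowE -colE => /matrixP/(_ 0 0); rewrite !mxE.
move: PE; move: P => Q QE.
by have := congr1 trmx QE; rewrite trmx_mul !trmxK -QE => <-.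
Qed.

Lemma orthproj_unique S P : (forall v : V, v *m P \in S) ->
  (forall v w : V, w \in S -> (v - v *m P) *m w^T = 0) -> P = orthproj S.
Proof.
move=> PS Porth; apply: mulmx_rV_eq => v; have [QS Qorth] := orthprojP S v.
apply/eqP; rewrite -subr_eq0; apply/eqP/rV_self_orth.
have dS : v *m P - v *m orthproj S \in S by exact: memvB.
have dE : v *m P - v *m orthproj S = (v - v *m orthproj S) - (v - v *m P).
  by rewrite opprB [RHS]addrC addrA subrK.
by rewrite {1}dE mulmxBl Qorth // Porth // subrr.
Qed.

Lemma orthproj_inj : injective (@orthproj R n).
Proof. by move=> S S' SS; apply/vspaceP => w; rewrite !mem_orthproj SS. Qed.

(** Factor the projection through a basis as [X *m B] with [B *m X = 1]; the trace of the product is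
    that of the identity of size [\dim S]. *)
Lemma mxtrace_orthproj S : \tr (orthproj S) = (\dim S)%:R.
Proof.
pose B : 'M[R]_(\dim S, n) := \matrix_(i < \dim S) (vbasis S)`_i.
have BS i : row i B \in S.
  by rewrite rowK; apply: vbasis_mem; apply: mem_nth; rewrite size_tuple.
have freeB : row_free B.
  apply/row_freeP; apply/row_freeP; rewrite -kermx_eq0; apply/rowV0P => u.
  move=> /sub_kermxP uB.
  have /freeP f := basis_free (vbasisP S).
  apply/rowP => i; rewrite mxE; apply: (f (fun i => u 0 i)).
  by rewrite -[RHS]uB mulmx_sum_row; apply: eq_bigr => j _; rewrite rowK.
have [X XE] : exists X, orthproj S = X *m B.
  apply/submxP/row_subP => i.
  have [wS _] := orthprojP S (delta_mx 0 i); rewrite rowE.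
  rewrite (coord_vbasis wS); apply: summx_sub => j _.
  apply: scalemx_sub; have <- : row j B = (vbasis S)`_j by rewrite rowK.
  exact: row_sub.
have BX : B *m X = 1%:M.
  apply: (row_free_inj freeB); rewrite mul1mx -mulmxA -XE.
  by apply/row_matrixP => i; rewrite row_mul orthproj_id.
by rewrite XE mxtrace_mulC BX mxtrace1.
Qed.

Lemma orthproj_surj P : P^T = P -> P *m P = P -> exists S, orthproj S = P.
Proof.
move=> Psym Pidem.
exists (limg (linfun (mulmxr P : V -> V))); apply/esym/orthproj_unique => [v|v w].
  by rewrite -[v *m P](lfunE (mulmxr P)) memv_img // memvf.
move=> /memv_imgP[u _ ->]; rewrite lfunE /= trmx_mul Psym mulmxA mulmxBl.
by rewrite -[v *m P *m P]mulmxA Pidem subrr mul0mx.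
Qed.

(** Describes the Grassmannian by polynomial equations in the entries, which makes its image
    closed. *)
Lemma orthproj_grassmannianE (m : nat) :
  @orthproj R n @` @grassmannian R n m =
  [set P | [/\ P^T = P, P *m P = P & \tr P = m%:R]].
Proof.
apply/seteqP; split=> [_ [S Sm <-]|P [Ps Pi Pt]] /=.
  by rewrite orthproj_sym orthproj_idem mxtrace_orthproj Sm.
have [S SP] := orthproj_surj Ps Pi; exists S => //.
by move: Pt; rewrite -SP mxtrace_orthproj => /eqP; rewrite eqr_nat => /eqP.
Qed.

End orthproj_theory.

Lemma sum_continuous (R : realType) (T : topologicalType) (I : Type) (r : seq I)
    (f : I -> T -> R) : (forall i, continuous (f i)) ->
  continuous (fun x => \sum_(i <- r) f i x).
Proof.
move=> cf; elim: r => [|i r IH].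
  by under eq_fun do rewrite big_nil; exact: cst_continuous.
under eq_fun do rewrite big_cons.
by move=> x; apply: continuousD; [exact: cf|exact: IH].
Qed.

Section grassmannian_topology.
Context (R : realType) (n : nat).

Lemma coord_mx_continuous (p q : nat) (i : 'I_p) (j : 'I_q) :
  continuous (fun M : 'M[R]_(p, q) => M i j).
Proof. exact: coord_continuous. Qed.

Lemma vec_mx_continuous (p q : nat) : continuous (@vec_mx R p q).
Proof.
move=> v A [P vP sPA].
(* Each [k] is the index of exactly one pair, so the intersection is just the set prescribed for
   that entry. *)
exists (fun _ k => \bigcap_(ij in [set ij | mxvec_index ij.1 ij.2 = k])
  P ij.1 ij.2).
  move=> i k; rewrite ord1; have [a b] := mxvec_indexP k.
  rewrite (_ : \bigcap_(_ in _) _ = P a b).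
    by have := vP a b; rewrite mxE.
  apply/seteqP; split=> [y Py|y Py [a1 b1] /= ab]; first exact: (Py (a, b)).
  by have /enum_rank_inj[-> ->] := cast_ord_inj ab.
by move=> w wP; apply: sPA => i j; rewrite mxE; apply: (wP 0 (mxvec_index i j) (i, j)).
Qed.

(** A diagonal entry is the sum of the squares of its row, so it dominates its own square, hence is
    at most 1, and dominates the squares of the other entries of the row. *)
Lemma sym_idem_coord (P : 'M[R]_n) i j : P^T = P -> P *m P = P -> `|P i j| <= 1.
Proof.
move=> Ps Pi.
have Pii k : P k k = \sum_l P k l ^+ 2.
  rewrite -[in LHS]Pi mxE; apply: eq_bigr => l _.
  by rewrite expr2 -[in X in _ * X = _]Ps mxE.
have Pk1 k l : P k l ^+ 2 <= P k k.
  rewrite Pii (bigD1 l) //= lerDl; apply: sumr_ge0 => *; exact: sqr_ge0.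
have P1 : P i i <= 1 by have := Pk1 i i; have := sqr_ge0 (P i i); nra.
by rewrite -(@expr_le1 _ 2 `|P i j|) // real_normK ?num_real // (le_trans (Pk1 i j)).
Qed.

Lemma orthproj_grassmannian_compact (m : nat) :
  compact (@orthproj R n @` @grassmannian R n m).
Proof.
rewrite orthproj_grassmannianE; set C := (X in compact X).
have -> : C = vec_mx @` (vec_mx @^-1` C : set 'rV[R]_(n * n)).
  apply/seteqP; split=> [P CP|_ [v Cv <-] //].
  by exists (mxvec P); rewrite /preimage /= mxvecK.
apply: continuous_compact; first by apply: continuous_subspaceT; exact: vec_mx_continuous.
apply: bounded_closed_compact.
  exists 1; split=> [|M M1 v [Ps Pi _]]; first exact: num_real.
  apply: le_trans (ltW M1); rewrite [leLHS]/Num.norm /= mx_normrE.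
  apply/bigmax_leP; split=> [|[i k] _ /=]; first exact: ler01.
  rewrite ord1; have [a b] := mxvec_indexP k.
  by have := sym_idem_coord a b Ps Pi; rewrite mxE.
apply: (@closed_comp _ _ _ C) => [v _|]; first exact: vec_mx_continuous.
have clz (f : 'M[R]_n -> R) c : continuous f -> closed [set P | f P = c].
  move=> cf; apply: (@closed_comp _ _ f [set x | x = c]) => [P _|].
    exact: cf.
  exact: closed_eq.
have -> : C = (\bigcap_(ij in [set: 'I_n * 'I_n])
      [set P : 'M[R]_n | P ij.1 ij.2 - P ij.2 ij.1 = 0]) `&`
    (\bigcap_(ij in [set: 'I_n * 'I_n])
      [set P : 'M[R]_n | \sum_k P ij.1 k * P k ij.2 - P ij.1 ij.2 = 0]) `&`
    [set P : 'M[R]_n | \sum_k P k k = m%:R].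
  apply/seteqP; split=> [P [Ps Pi Pt]|P [[Ps Pi] Pt]] /=.
    split; last exact: Pt.
    split=> [[i j] _|[i j] _] /=; apply/eqP; rewrite subr_eq0; apply/eqP.
      by rewrite -[in LHS]Ps mxE.
    by rewrite -[in RHS]Pi mxE.
  split; last exact: Pt.
    apply/matrixP => i j; have /= /eqP := Ps (i, j) I.
    by rewrite subr_eq0 mxE => /eqP.
  apply/matrixP => i j; have /= /eqP := Pi (i, j) I.
  by rewrite subr_eq0 mxE => /eqP.
apply: closedI; [apply: closedI; apply: closed_bigI => -[i j] _ /=|]; apply: clz.
- by move=> P; apply: continuousB; exact: coord_mx_continuous.
- move=> P; apply: continuousB; last exact: coord_mx_continuous.
  by apply: sum_continuous => k Q; apply: continuousM; exact: coord_mx_continuous.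
- by apply: sum_continuous => k; exact: coord_mx_continuous.
Qed.

(** Neighbourhoods in the initial topology come from preimages under [orthproj], so a cluster point
    of the image filter lifts to one of the filter. *)
Lemma grassmannian_compact (m : nat) : compact (@grassmannian R n m).
Proof.
move=> F FF FG; have FfF : ProperFilter (@orthproj R n @ F) by exact: fmap_proper_filter.
have [|_ [[S GS <-] clS]] := @orthproj_grassmannian_compact m _ FfF.
  rewrite nbhs_simpl /=; apply: filterS FG => S GS; exact: imageP.
exists S; split=> // A B FA [_ [[B0 oB0 <-] SB0 B0B]].
have fA : (@orthproj R n @ F) (@orthproj R n @` A).
  by rewrite nbhs_simpl /=; apply: filterS FA => S' AS'; exact: imageP.
have fB : nbhs (orthproj S) B0 by apply: open_nbhs_nbhs.
have [_ [[S' AS' <-] B0S']] := clS _ _ fA fB.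
by exists S'; split=> //; exact: B0B.
Qed.

Lemma orthproj_continuous : continuous (@orthproj R n : subspaces R n -> 'M[R]_n).
Proof. exact: initial_continuous. Qed.

Lemma subspaces_hausdorff : hausdorff_space (subspaces R n).
Proof.
rewrite open_hausdorff => S S' SS.
have : hausdorff_space 'M[R]_n by exact: norm_hausdorff.
rewrite open_hausdorff => /(_ (orthproj S) (orthproj S')).
case=> [|[A B] /= [AS BS] [oA oB AB]].
  by apply: contra SS => /eqP/orthproj_inj ->.
exists (@orthproj R n @^-1` A, @orthproj R n @^-1` B) => /=.
  by split; rewrite inE /=; apply/set_mem.
split; [by exists A|by exists B|].
apply/eqP; rewrite -subset0 => S0 [AS0 BS0]; move/eqP: AB => AB.
by have : (A `&` B) (orthproj S0) by []; rewrite AB.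
Qed.

Lemma hausdorff_setX (A B : topologicalType) : hausdorff_space A ->
  hausdorff_space B -> hausdorff_space (A * B)%type.
Proof.
move=> hA hB [a b] [a' b'] cl; congr (_, _).
  apply: hA => P Q aP aQ.
  have [[x y] [/= ]] := cl (fst @^-1` P) (fst @^-1` Q)
    (cvg_fst aP) (cvg_fst aQ).
  by exists x.
apply: hB => P Q aP aQ.
have [[x y] [/= ]] := cl (snd @^-1` P) (snd @^-1` Q) (cvg_snd aP) (cvg_snd aQ).
by exists y.
Qed.

End grassmannian_topology.

(** * Measurability of the cut-off set *)

Lemma dist_continuous (R : realType) (W : normedModType R) (y : W) :
  continuous (fun x => `|x - y|).
Proof. by move=> x; apply: cvg_norm; apply: cvgB; [exact: cvg_id|exact: cvg_cst]. Qed.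

Section exhaustion.
Context (R : realType) (n : nat) (U : set 'rV[R]_n) (oU : open U).
Local Notation V := 'rV[R]_n.

(** The second clause keeps the distance to the complement of [U] at least [1/(k+1)], in a form that
    also makes sense when that complement is empty. *)
Definition inner_part (k : nat) : set V :=
  [set x | `|x| <= k%:R /\ forall y, `|x - y| < k.+1%:R^-1 -> U y].

Lemma inner_part_compact k : compact (inner_part k).
Proof.
apply: bounded_closed_compact.
  exists k%:R; split=> [|M kM x [xk _]]; first exact: num_real.
  exact: le_trans xk (ltW kM).
have -> : inner_part k = [set x | `|x| <= k%:R] `&`
    \bigcap_(y in ~` U) [set x | k.+1%:R^-1 <= `|x - y|].
  apply/seteqP; split=> [x [xk xU]|x [xk xU]]; split=> //.
    by move=> y Uy /=; rewrite leNgt; apply/negP => /xU.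
  by move=> y; apply: contraPP => Uy; apply/negP; rewrite -leNgt; exact: xU.
apply: closedI.
  by apply: (closed_comp _ (@closed_le _ k%:R)) => x _; exact: norm_continuous.
apply: closed_bigI => y _.
apply: (@closed_comp V R (fun x : V => `|x - y|) [set t | k.+1%:R^-1 <= t]) => [x _|].
  exact: dist_continuous.
exact: closed_ge.
Qed.

Lemma inner_part_sub k : inner_part k `<=` U.
Proof. by move=> x [_]; apply; rewrite subrr normr0 invr_gt0. Qed.

Lemma inner_part_nd k l : (k <= l)%N -> inner_part k `<=` inner_part l.
Proof.
move=> kl x [xk xU]; split; first by rewrite (le_trans xk) // ler_nat.
move=> y xy; apply: xU; apply: lt_le_trans xy _.
by rewrite lef_pV2 ?posrE // ler_nat ltnS.
Qed.

Lemma inner_part_cover : U `<=` \bigcup_k (inner_part k)°.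
Proof.
move=> x Ux; have /nbhs_ballP[r r0 rU] : nbhs x U by exact: open_nbhs_nbhs.
(* [k + 1] exceeds the norm of [x] plus 1, which bounds the points within distance 1 of [x], and
   exceeds [2 / r], so that [1/(k+2)] is below [r / 2]. *)
pose k := Num.trunc (`|x| + 1 + 2 / r); exists k.+1 => //.
have : `|x| + 1 + 2 / r < k.+1%:R by exact: truncnS_gt.
have x0 : 0 <= `|x| by []; have r20 : 0 < 2 / r by rewrite divr_gt0.
move=> kr; apply/nbhs_ballP; exists (Num.min 1 (r / 2)) => [|z].
  by rewrite /= lt_min ltr01 divr_gt0.
rewrite -ball_normE /= lt_min => /andP[xz1 xzr]; split=> [|y zy].
  have := lerB_dist z x; rewrite distrC; lra.
apply: rU; rewrite -ball_normE /= -(subrK z x) -addrA.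
apply: le_lt_trans (ler_normD _ _) _; rewrite [ltRHS]splitr ltrD //.
apply: lt_trans zy _; rewrite invf_plt ?posrE ?divr_gt0 // invf_div.
by rewrite -natr1; lra.
Qed.

End exhaustion.

Section caratheodory_sum.
Context (R : realType) (T : Type).
Local Open Scope ereal_scope.
Implicit Types (a : set T -> \bar R).

(** Two inequalities between finite numbers that add up to an equality are both equalities. *)
Lemma finite_caratheodory_split (a b : set T -> \bar R) (E B : set T) :
  (forall A, 0 <= a A) -> (forall A, 0 <= b A) ->
  a B <= a (B `&` E) + a (B `&` ~` E) -> b B <= b (B `&` E) + b (B `&` ~` E) ->
  (fun A => a A + b A).-caratheodory E -> a B < +oo -> b B < +oo ->
  a B = a (B `&` E) + a (B `&` ~` E) /\ b B = b (B `&` E) + b (B `&` ~` E).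
Proof.
move=> a0 b0 aB bB mE aBfin bBfin; have := mE B.
have fa : a B \is a fin_num by rewrite ge0_fin_numE.
have fb : b B \is a fin_num by rewrite ge0_fin_numE.
rewrite addeACA.
move: (a B) (b B) (a (B `&` E)) (a (B `&` ~` E)) (b (B `&` E)) (b (B `&` ~` E))
  fa fb aB bB (a0 (B `&` E)) (a0 (B `&` ~` E)) (b0 (B `&` E)) (b0 (B `&` ~` E)).
move=> [x| |] // [y| |] // [x1| |] // [x2| |] // [y1| |] // [y2| |] //= _ _.
rewrite -!EFinD !lee_fin => h1 h2 h3 h4 h5 h6 [h7].
by split; congr EFin; lra.
Qed.

(** The sum can be separated only on sets where both terms are finite, so [E] is treated as the
    union of its parts in the [Y k]. A bare set function [a] is allowed because it will be the
    weight. *)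
Lemma caratheodory_sumr (a : set T -> \bar R) (b : {outer_measure set T -> \bar R})
    (E : set T) (Y : (set T)^nat) :
  (forall A, 0 <= a A) -> {homo a : A B / A `<=` B >-> A <= B} ->
  (forall A B, a A <= a (A `&` B) + a (A `&` ~` B)) ->
  (fun A => a A + b A).-caratheodory E ->
  (forall k, b.-caratheodory (Y k)) -> (forall k, a (Y k) < +oo) ->
  (forall k, b (Y k) < +oo) -> E `<=` \bigcup_k Y k -> b.-caratheodory E.
Proof.
move=> a0 ale asub mE mY aY bY EY.
rewrite -(setIidl EY) setI_bigcupr; apply: caratheodory_measurable_bigcup => k.
apply: le_caratheodory_measurable => B.
have BY : B `&` Y k `<=` Y k by exact: subIsetr.
have [_ bsplit] := finite_caratheodory_split a0 (outer_measure_ge0 b)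
  (asub (B `&` Y k) E) (le_outer_measureIC b E (B `&` Y k)) mE
  (le_lt_trans (ale _ _ BY) (aY k)) (le_lt_trans (le_outer_measure b _ _ BY) (bY k)).
rewrite (mY k B) bsplit -addeA; apply: leeD.
  by apply: le_outer_measure => x [Bx [Ex Yx]].
apply: le_trans (le_outer_measureIC b (Y k) _) _; apply: leeD.
  by apply: le_outer_measure => x [[Bx EYx] Yx]; split=> // Ex; exact: EYx.
by apply: le_outer_measure => x [[Bx EYx] Yx].
Qed.

End caratheodory_sum.

Section cylinders.
Context (R : realType) (n m : nat) (U : set 'rV[R]_n) (oU : open U).
Local Notation Gr := (@grassmannian R n m).
Variable (V : {outer_measure set ('rV[R]_n * subspaces R n)%type -> \bar R}).
Hypothesis varV : varifold m U V.
Local Open Scope ereal_scope.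

Lemma weight_subadditive (A B : set 'rV[R]_n) :
  weight m V A <= weight m V (A `&` B) + weight m V (A `&` ~` B).
Proof.
apply: le_trans (outer_measureU2 V _ _); apply: le_outer_measure => -[x S] [/= Ax GS].
by have [Bx|Bx] := pselect (B x); [left|right].
Qed.

Lemma weight_ge0 A : 0 <= weight m V A.
Proof. exact: outer_measure_ge0. Qed.

Lemma le_weight : {homo weight m V : A B / A `<=` B >-> A <= B}.
Proof. by move=> A B AB; apply: le_outer_measure => -[x S] [/= /AB]. Qed.

Lemma relopen_cylinder (H : set 'rV[R]_n) : open H -> H `<=` U ->
  relopen (U `*` Gr) (H `*` Gr).
Proof.
move=> oH HU; exists (fst @^-1` H); last first.
  apply/seteqP; split=> -[x S] /=; first by move=> [Hx [_ GS]].
  by move=> [Hx GS]; split=> //; split=> //; exact: HU.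
by apply: open_comp oH => p _; exact: cvg_fst.
Qed.

Lemma weight_inner_part k : weight m V (inner_part U k)° < +oo.
Proof.
have [_ Kfin _ _ _] := varV.
apply: le_lt_trans (le_weight (@interior_subset _ _)) _; apply: Kfin.
  by apply: compact_setX; [exact: inner_part_compact|exact: grassmannian_compact].
by move=> [x S] [/= /inner_part_sub].
Qed.

(* Compactness of the Grassmannian enters through the tube lemma. *)
Lemma weight_adherent (A : set 'rV[R]_n) (e : R) : A `<=` U -> (0 < e)%R ->
  weight m V A < +oo ->
  exists H, [/\ open H, H `<=` U, A `<=` H & weight m V H <= weight m V A + e%:E].
Proof.
move=> AU e0 Afin; have [_ _ _ _ rV] := varV.
have AGU : A `*` Gr `<=` U `*` Gr by move=> [x S] [/= /AU].
have [G [[G0 oG0 GE] AG lG]] := outer_regular_adherent rV AGU e0 Afin.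
pose H := [set x | U x /\ forall S, Gr S -> G0 (x, S)].
have HG : H `*` Gr `<=` G.
  by move=> [x S] [/= [Ux Hx] GS]; rewrite -GE; split=> //; exact: Hx.
exists H; split.
- rewrite openE => x [Ux Hx].
  have := (compact_near_coveringP _).1 (@grassmannian_compact R n m)
    'rV[R]_n (nbhs x) (fun y S => G0 (y, S)) _.
  move=> /(_ _) h; apply: filterI; first exact: open_nbhs_nbhs.
  apply: h => S GS.
  have : nbhs (x, S) G0 by apply: open_nbhs_nbhs; split=> //; exact: Hx.
  by move=> [[P Q] /= [xP SQ] PQ]; exists (Q, P) => //= -[S' y] [/= QS' Py]; exact: PQ.
- by move=> x [].
- move=> x Ax; split; first exact: AU.
  move=> S GS; have : G (x, S) by apply: AG.
  by rewrite -GE => -[].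
- by apply: le_trans lG; exact: le_outer_measure.
Qed.

(* The hypothesis tests [V] on cylinders only.  Outer regularity of the weight
   writes [E], locally, as a G_delta set minus a set of weight zero, and both
   have measurable cylinders. *)
Lemma caratheodory_cylinder (b : {outer_measure set 'rV[R]_n -> \bar R})
    (E : set 'rV[R]_n) : E `<=` U ->
  (fun A => weight m V A + b A).-caratheodory E ->
  (forall k, b (inner_part U k)° < +oo) -> V.-caratheodory (E `*` Gr).
Proof.
move=> EU mE bY; have [_ _ mV _ _] := varV.
pose Y k := (inner_part U k)°.
have oY k : open (Y k) by exact: open_interior.
have YU k : Y k `<=` U.
  exact: subset_trans (@interior_subset _ _) (@inner_part_sub _ _ _ k).
have -> : E `*` Gr = \bigcup_k ((E `&` Y k) `*` Gr).
  apply/seteqP; split=> [[x S] [/= Ex GS]|[x S] [k _ [/= [Ex _] GS]]] //.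
  by have [k _ Yx] := inner_part_cover oU (EU _ Ex); exists k.
apply: caratheodory_measurable_bigcup => k.
have FU : E `&` Y k `<=` U by move=> x [/EU].
have Ffin : weight m V (E `&` Y k) < +oo.
  by apply: le_lt_trans (weight_inner_part k); apply: le_weight; exact: subIsetr.
have /choice[H HP] (j : nat) : exists H, [/\ open H, H `<=` Y k, E `&` Y k `<=` H &
    weight m V (H `&` ~` E) <= (j.+1%:R^-1)%:E].
  have j0 : (0 < j.+1%:R^-1 :> R)%R by rewrite invr_gt0.
  have [H [oH HU FH lH]] := weight_adherent FU j0 Ffin.
  have HY : H `&` Y k `<=` Y k by exact: subIsetr.
  exists (H `&` Y k); split=> //; first exact: openI.
    by move=> x [Ex Yx]; split=> //; exact: FH.
  (* Inside [Y k] both terms are finite, so the weight alone splits along [E]; this turns closeness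
     of the weights into a small weight of the difference. *)
  have [wsplit _] := finite_caratheodory_split weight_ge0
    (outer_measure_ge0 b) (weight_subadditive (H `&` Y k) E)
    (le_outer_measureIC b E (H `&` Y k)) mE
    (le_lt_trans (le_weight HY) (weight_inner_part k))
    (le_lt_trans (le_outer_measure b _ _ HY) (bY k)).
  have fF : weight m V (E `&` Y k) \is a fin_num.
    by rewrite ge0_fin_numE // outer_measure_ge0.
  rewrite -(leeD2lE _ _ fF).
  apply: le_trans (le_trans (le_weight (@subIsetl _ H (Y k))) lH).
  rewrite [leRHS]wsplit leeD2r //; apply: le_weight => x [Ex Yx].
  by do 2 split=> //; exact: FH.
pose N := (\bigcap_j H j) `\` (E `&` Y k).
have -> : (E `&` Y k) `*` Gr = ~` (\bigcup_j (~` (H j `*` Gr))) `\` (N `*` Gr).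
  apply/seteqP; split=> [[x S] [/= Fx GS]|[x S] [/= HxS NS]].
    split; last by move=> [[_ /(_ Fx)]].
    by move=> [j _]; apply; split=> //; have [_ _ + _] := HP j; apply.
  have HGr j : (H j `*` Gr) (x, S).
    by apply: contrapT => h; apply: HxS; exists j.
  split; last by have [] := HGr 0%N.
  apply: contrapT => Fx; apply: NS; split; last by have [] := HGr 0%N.
  by split=> // j _; have [] := HGr j.
apply: caratheodory_measurable_setD.
  apply/caratheodory_measurable_setC/caratheodory_measurable_bigcup => j.
  apply/caratheodory_measurable_setC/mV/relopen_cylinder; have [oH HY _ _] := HP j => //.
  exact: subset_trans HY (YU k).
apply: null_caratheodory; apply/eqP; rewrite eq_le outer_measure_ge0 andbT.
apply/lee_addgt0Pr => e e0; rewrite add0e.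
have ej : (e^-1 < (Num.trunc e^-1).+1%:R)%R by exact: truncnS_gt.
have [_ HY _ lH] := HP (Num.trunc e^-1).
apply: (@le_trans _ _ (weight m V (H (Num.trunc e^-1) `&` ~` E))).
  apply: le_weight => x [Hx Fx]; split; first exact: Hx.
  by move=> Ex; apply: Fx; split=> //; apply: HY; exact: Hx.
apply: le_trans lH _; rewrite lee_fin -[leRHS]invrK lef_pV2 ?posrE ?invr_gt0 //.
exact: ltW.
Qed.

End cylinders.

(** * The first variation as an integral *)

Section borel_transfer.
Context (R : realType) (T : ptopologicalType).
Local Open Scope ereal_scope.
Implicit Types (mu : {outer_measure set T -> \bar R}) (f : T -> R).

Let borel := g_sigma_algebraType (@open T).

Lemma continuous_measurable_open d (X : measurableType d) (h : X -> T) f :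
  (forall G, open G -> measurable (h @^-1` G)) -> continuous f ->
  measurable_fun setT (f \o h).
Proof.
move=> hO /continuousP cf.
apply: (measurability _ (measurable_realfun.RGenOpens.measurableE R)).
move=> _ [_ [x [y ->]] <-]; rewrite setTI comp_preimage; apply/hO/cf.
exact: interval_open.
Qed.

(* The Caratheodory sigma-algebras of two measures differ, so integrals with
   respect to them are compared on the Borel sigma-algebra. *)
Section measure.
Variables (mu : {outer_measure set T -> \bar R}).
Hypothesis mO : forall G, open G -> mu.-caratheodory G.

Let cara := caratheodory_type mu.

Lemma borel_caratheodory (A : set T) : (measurable : set (set borel)) A -> mu.-caratheodory A.
Proof.
apply: smallest_sub; last exact: mO.
split; first exact: caratheodory_measurable_set0.
  by move=> B mB; rewrite setTD; exact: caratheodory_measurable_setC.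
by move=> F mF; exact: caratheodory_measurable_bigcup.
Qed.

Definition borel_measure_fun (A : set borel) : \bar R := mu A.

Let borel_measure0 : borel_measure_fun set0 = 0.
Proof. exact: outer_measure0. Qed.

Let borel_measure_ge0 A : 0 <= borel_measure_fun A.
Proof. exact: outer_measure_ge0. Qed.

Let borel_measure_sigma : semi_sigma_additive borel_measure_fun.
Proof.
move=> F mF tF mU.
apply: (@measure_semi_sigma_additive _ cara R (mu : set cara -> \bar R) F) => //.
  by move=> k; exact: borel_caratheodory.
exact: borel_caratheodory.
Qed.

HB.instance Definition _ := isMeasure.Build _ borel R borel_measure_fun
  borel_measure0 borel_measure_ge0 borel_measure_sigma.

Definition borel_measure : {measure set borel -> \bar R} := borel_measure_fun.

Let id_measurable : measurable_fun setT (idfun : cara -> borel).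
Proof. by move=> _ A mA; rewrite setTI; exact: borel_caratheodory. Qed.

Lemma continuous_measurable_cara f : continuous f ->
  measurable_fun setT (f : cara -> R).
Proof. by move=> cf; apply: (@continuous_measurable_open _ cara idfun). Qed.

Lemma continuous_measurable_borel f : continuous f ->
  measurable_fun setT (f : borel -> R).
Proof.
move=> cf; apply: (@continuous_measurable_open _ borel idfun) => // G oG.
exact: sub_sigma_algebra.
Qed.

(** The Borel measure is the image of [mu] under the identity from the Caratheodory sigma-algebra to
    the smaller Borel one. *)
Lemma integral_borel f : continuous f ->
  (mu : set cara -> \bar R).-integrable setT (EFin \o f) ->
  borel_measure.-integrable setT (EFin \o f) /\
  \int[mu : set cara -> \bar R]_x (f x)%:E = \int[borel_measure]_x (f x)%:E.
Proof.
move=> cf fi.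
have mf : measurable_fun setT (fun x : borel => (f x)%:E).
  by apply/measurable_EFinP; exact: continuous_measurable_borel.
split; first exact: (@integrable_pushforward _ _ cara borel R idfun id_measurable
  (mu : set cara -> \bar R) setT _ mf fi).
by rewrite -[LHS](@integral_pushforward _ _ cara borel R idfun id_measurable
  (mu : set cara -> \bar R) setT _ mf fi).
Qed.

Lemma bounded_integrable f (K : set T) (C : R) : continuous f ->
  mu.-caratheodory K -> mu K < +oo ->
  (forall x, ~ K x -> f x = 0%R) -> (forall x, `|f x| <= C)%R ->
  (mu : set cara -> \bar R).-integrable setT (EFin \o f).
Proof.
move=> cf mK Kfin f0 fC.
have mK' : measurable (K : set cara) := mK.
have mf : measurable_fun setT (f : cara -> R) := continuous_measurable_cara cf.
have fE : (EFin \o f) = (EFin \o f) \_ K.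
  apply/funext => x; rewrite patchE; case: ifPn => // /negP Kx.
  by rewrite /= f0 // => Kx'; apply: Kx; rewrite inE.
rewrite fE; apply/(@integrable_mkcond _ cara R _ K (EFin \o f) mK').
apply: measurable_bounded_integrable => //.
  exact: measurable_funTS.
exists C; split=> [|M CM x _]; first exact: num_real.
exact: le_trans (fC x) (ltW CM).
Qed.


End measure.
End borel_transfer.

Section integral_sum_measure.
Context (R : realType) (T : ptopologicalType).
Local Open Scope ereal_scope.
Variables (mu nu la : {outer_measure set T -> \bar R}).
Hypotheses (muO : forall G, open G -> mu.-caratheodory G)
  (nuO : forall G, open G -> nu.-caratheodory G)
  (laO : forall G, open G -> la.-caratheodory G)
  (muE : forall A, mu A = nu A + la A).

Lemma integral_sum_measure (f : T -> R) : continuous f ->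
  (mu : set (caratheodory_type mu) -> \bar R).-integrable setT (EFin \o f) ->
  (nu : set (caratheodory_type nu) -> \bar R).-integrable setT (EFin \o f) ->
  (la : set (caratheodory_type la) -> \bar R).-integrable setT (EFin \o f) ->
  \int[mu : set (caratheodory_type mu) -> \bar R]_x (f x)%:E =
  \int[nu : set (caratheodory_type nu) -> \bar R]_x (f x)%:E +
  \int[la : set (caratheodory_type la) -> \bar R]_x (f x)%:E.
Proof.
move=> cf /(integral_borel muO cf)[_ ->] /(integral_borel nuO cf)[inu ->]
  /(integral_borel laO cf)[ila ->].
rewrite -integral_measure_add //.
apply: eq_measure_integral => A _ _; apply: etrans (muE A) (esym _).
exact: (measure_addE (borel_measure nuO) (borel_measure laO) A).
Qed.

End integral_sum_measure.

Section diff_app.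
Context (R : realType) (V W : normedModType R).

Lemma diffD_app (f g : V -> W) x v : differentiable f x -> differentiable g x ->
  'd (fun y => f y + g y) x v = 'd f x v + 'd g x v.
Proof. by move=> df dg; rewrite (@diffD _ _ _ f g). Qed.

Lemma diffZ_app a (f : V -> W) x v : differentiable f x ->
  'd (fun y => a *: f y) x v = a *: 'd f x v.
Proof. by move=> df; rewrite (@diffZ _ _ _ f a). Qed.

End diff_app.

Section first_variation_density.
Context (R : realType) (n : nat) (U : set 'rV[R]_n).
Local Notation V := 'rV[R]_n.
Local Notation pairs := (V * subspaces R n)%type.

Definition variation_density (g : V -> V) (p : pairs) : R :=
  \tr (jacobian g p.1 *m orthproj p.2).

Lemma variation_densityE g p : variation_density g p =
  \sum_i \sum_k ('d g (p.1) (delta_mx 0 i) : V) 0 k * orthproj p.2 k i.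
Proof.
by apply: eq_bigr => i _; rewrite mxE; apply: eq_bigr => k _; rewrite mxE.
Qed.

Lemma variation_density_continuous (g : test_fun U) : continuous (variation_density g).
Proof.
rewrite (_ : variation_density g = fun p => \sum_i \sum_k
  ('d g (p.1) (delta_mx 0 i) : V) 0 k * orthproj p.2 k i); last first.
  by apply/funext => p; exact: variation_densityE.
apply: sum_continuous => i; apply: sum_continuous => k p; apply: continuousM.
  apply: (@continuous_comp _ _ _ (fun p : pairs => 'd g (p.1) (delta_mx 0 i) : V)
    (fun x : V => x 0 k)); last exact: coord_rV_continuous.
  apply: (@continuous_comp _ _ _ fst (fun x => 'd g x (delta_mx 0 i) : V)).
    exact: cvg_fst.
  by have [_ /(_ (delta_mx 0 i)) h] := test_fun_smooth g 1; exact: h.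
apply: (@continuous_comp _ _ _ (fun p : pairs => orthproj p.2)
  (fun M : 'M[R]_n => M k i)); last exact: coord_mx_continuous.
apply: (@continuous_comp _ _ _ snd (@orthproj R n : subspaces R n -> 'M[R]_n)).
  exact: cvg_snd.
exact: orthproj_continuous.
Qed.

Lemma variation_density_eq0 (g : test_fun U) p : ~ spt g p.1 ->
  variation_density g p = 0.
Proof.
move=> gp; rewrite variation_densityE; move: (orthproj _) => P.
rewrite big1 // => i _; rewrite big1 // => k _.
have [dg _] := test_fun_smooth g 1.
rewrite -deriveE // (@near_eq_derive _ _ _ _ (cst 0)) ?derive_cst ?mxE ?mul0r //.
have : nbhs p.1 (~` spt g).
  by apply: open_nbhs_nbhs; split=> //; apply: closed_openC; exact: closed_closure.
by apply: filterS => x; exact: spt_eq0.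
Qed.

(** The integrals run over pairs with a subspace of any dimension, so the density is to be bounded
    on all of them; finitely many Grassmannians make up the space. *)
Lemma subspaces_compact : compact [set: subspaces R n].
Proof.
rewrite (_ : setT = \big[setU/set0]_(k < n.+1) @grassmannian R n k).
  by apply: bigsetU_compact => k _; exact: grassmannian_compact.
apply/esym/seteqP; split=> // S _; rewrite -(bigcup_mkord n.+1 (@grassmannian R n)).
exists (\dim (S : {vspace V})) => //=.
by rewrite ltnS (leq_trans (dimvS (subvf _))) // dimvf /dim /= mul1n.
Qed.

Lemma variation_density_bounded (g : test_fun U) :
  exists C, forall p, `|variation_density g p| <= C.
Proof.
have : compact (variation_density g @` (spt g `*` [set: subspaces R n])).
  apply: continuous_compact.
    by apply: continuous_subspaceT; exact: variation_density_continuous.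
  by apply: compact_setX; [exact: test_compact|exact: subspaces_compact].
move=> /compact_bounded[M [_ hM]]; exists (Num.max (M + 1) 0) => p.
have [gp|gp] := pselect (spt g p.1); last first.
  by rewrite variation_density_eq0 // normr0 le_max lexx orbT.
by rewrite le_max hM // ?ltrDl //; exists p.
Qed.

Lemma variation_densityD (g h : V -> V) p : differentiable g p.1 ->
  differentiable h p.1 -> variation_density (fun x => g x + h x) p =
  variation_density g p + variation_density h p.
Proof.
move=> dg dh; have dE v := diffD_app v dg dh.
rewrite !variation_densityE; move: (orthproj _) => P.
rewrite -big_split; apply: eq_bigr => i _ /=.
rewrite -big_split; apply: eq_bigr => k _ /=.
rewrite -mulrDl; congr (_ * _).
by apply: etrans (congr1 (fun x : V => x 0 k) (dE _)) _; exact: mxE.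
Qed.

Lemma variation_densityZ a (g : V -> V) p : differentiable g p.1 ->
  variation_density (fun x => a *: g x) p = a * variation_density g p.
Proof.
move=> dg; have dE v := diffZ_app a v dg.
rewrite !variation_densityE; move: (orthproj _) => P.
rewrite mulr_sumr; apply: eq_bigr => i _.
rewrite mulr_sumr; apply: eq_bigr => k _ /=.
rewrite mulrA; congr (_ * _).
by apply: etrans (congr1 (fun x : V => x 0 k) (dE _)) _; exact: mxE.
Qed.

Lemma test_fun_differentiable (g : test_fun U) x : differentiable (g : V -> V) x.
Proof. by have [dg _] := test_fun_smooth g 1. Qed.

Local Open Scope ereal_scope.
Implicit Types mu : {outer_measure set pairs -> \bar R}.

(** What integrating the density requires of a varifold, with full fibres so that the dimension [m]
    does not appear. *)
Definition locally_finite_borel mu := (forall G, open G -> mu.-caratheodory G) /\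
  (forall K, compact K -> K `<=` U -> mu (K `*` [set: subspaces R n]) < +oo).

Lemma variation_density_integrable mu (g : test_fun U) : locally_finite_borel mu ->
  (mu : set (caratheodory_type mu) -> \bar R).-integrable setT
    (EFin \o variation_density g).
Proof.
move=> [muO muK]; have [C gC] := variation_density_bounded g.
apply: (bounded_integrable muO (K := spt g `*` [set: subspaces R n]) (C := C)
  (@variation_density_continuous g)) => //.
- rewrite -[_ `*` _]setCK; apply/caratheodory_measurable_setC/muO/closed_openC.
  rewrite (_ : _ `*` _ = fst @^-1` (spt g)); last by apply/seteqP; split=> -[x S] //= [].
  by apply: closed_comp => [p _|]; [exact: cvg_fst|exact: closed_closure].
- by apply: muK; [exact: test_compact|exact: test_sub].
- by move=> p gp; apply: variation_density_eq0 => ?; exact: gp.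
Qed.

Lemma first_variation_linear mu : locally_finite_borel mu ->
  test_linear (first_variation U mu).
Proof.
move=> fmu; have ig g := variation_density_integrable g fmu.
have fg (g : test_fun U) :
    \int[mu : set (caratheodory_type mu) -> \bar R]_p (variation_density g p)%:E
      \is a fin_num by have := integrable_fin_num measurableT (ig g).
split=> [g h|a g].
  rewrite /first_variation -fineD; [|exact: (fg g)|exact: (fg h)].
  congr fine; rewrite -integralD //; [|exact: (ig g)|exact: (ig h)].
  apply: eq_integral => p _; rewrite -EFinD; congr EFin.
  exact: (variation_densityD (test_fun_differentiable g _) (test_fun_differentiable h _)).
rewrite /first_variation -[a in RHS]/(fine a%:E) -fineM //; last exact: (fg g).
congr fine; rewrite -integralZl //; last exact: (ig g).
apply: eq_integral => p _; rewrite -EFinM; congr EFin.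
exact: (variation_densityZ a (test_fun_differentiable g _)).
Qed.

Lemma first_variation_sum mu nu la : locally_finite_borel mu ->
  locally_finite_borel nu -> locally_finite_borel la ->
  (forall A, mu A = nu A + la A) -> forall g : test_fun U,
  first_variation U mu g = (first_variation U nu g + first_variation U la g)%R.
Proof.
move=> fmu fnu fla muE g.
have ig rho frho := variation_density_integrable (mu := rho) g frho.
have fnuN := integrable_fin_num measurableT (ig _ fnu).
have flaN := integrable_fin_num measurableT (ig _ fla).
rewrite /first_variation -fineD; [|exact: fnuN|exact: flaN].
congr fine; apply: (integral_sum_measure fmu.1 fnu.1 fla.1 muE
  (@variation_density_continuous g)); exact: ig.
Qed.

End first_variation_density.

(** * Integral bounds for a functional *)

(** The first level below [2 * t] dominates the geometric sum of the later ones. The bound [2 * c]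
    is carried along for the induction: it controls the tail once that level is reached. *)
Lemma dyadic_sum_le (R : realType) (N : nat) (c t : R) : 0 < c -> 0 <= t ->
  \sum_(i < N) (c / 2 ^+ i) * (c / 2 ^+ i < 2 * t)%R%:R <= 4 * t /\
  \sum_(i < N) (c / 2 ^+ i) * (c / 2 ^+ i < 2 * t)%R%:R <= 2 * c.
Proof.
move=> c0 t0; elim: N c c0 => [|N IH] c c0.
  by rewrite !big_ord0; split; rewrite mulr_ge0 // ltW.
have c20 : 0 < c / 2 by rewrite divr_gt0.
rewrite big_ord_recl /= expr0 divr1.
rewrite (eq_bigr (fun i : 'I_N => (c / 2 / 2 ^+ i) * (c / 2 / 2 ^+ i < 2 * t)%R%:R)).
  have [h1 h2] := IH _ c20.
  by case: ltP => ct; rewrite ?mulr1 ?mulr0; split; lra.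
by move=> i _; rewrite /bump /= add1n exprS invfM mulrA.
Qed.

Section variation_integral.
Context (R : realType) (n : nat) (U : set 'rV[R]_n) (oU : open U).
Local Notation V := 'rV[R]_n.
Variables (T : test_fun U -> R) (mu : {outer_measure set V -> \bar R}).
Hypotheses (linT : test_linear T) (radmu : radon_over U mu)
  (muT : forall G, open G -> G `<=` U -> mu G = variation_on T G).
Local Notation cara := (caratheodory_type mu).
Local Notation mu' := (mu : set cara -> \bar R).

Lemma test_fun_enorm_bounded (h : test_fun U) :
  exists2 c, 0 < c & forall x, enorm (h x) < c.
Proof.
have : compact ((@enorm R n \o h) @` spt h).
  apply: continuous_compact; last exact: test_compact.
  apply: continuous_subspaceT => x; apply: continuous_comp.
    exact: test_fun_continuous.
  exact: enorm_continuous.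
move=> /compact_bounded[M [_ hM]].
exists (`|M| + 2) => [|x]; first by rewrite ltr_wpDl.
have [hx|/spt_eq0 ->] := pselect (spt h x); last by rewrite enorm0 ltr_wpDl.
have : `|enorm (h x)| <= `|M| + 1.
  by apply: hM; [rewrite (le_lt_trans (ler_norm M)) // ltrDl|exists x].
by rewrite ger0_norm ?enorm_ge0 //; lra.
Qed.

Lemma enorm_test_fun_continuous (h : test_fun U) : continuous (fun x => enorm (h x)).
Proof.
move=> x; apply: (@continuous_comp _ _ _ (h : V -> V)).
  exact: test_fun_continuous.
exact: enorm_continuous.
Qed.

(** [G] may have infinite measure, but the compact support of [h] has finite measure and outer
    regularity enlarges it only slightly. *)
Lemma test_fun_nbhs_finite (h : test_fun U) (G : set V) : open G -> G `<=` U ->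
  spt h `<=` G ->
  exists H, [/\ open H, H `<=` G, spt h `<=` H & (mu H < +oo)%E].
Proof.
move=> oG GU hG; have [_ muK _ _ rU] := radmu.
have hfin : (mu (spt h) < +oo)%E by apply: muK; [exact: test_compact|exact: test_sub].
have [H [/(relopen_openE _ oU)[oH HU] hH lH]] :=
  outer_regular_adherent rU (@test_sub _ _ _ h) ltr01 hfin.
exists (H `&` G); split.
- exact: openI.
- exact: subIsetr.
- by move=> x hx; split; [exact: hH|exact: hG].
- apply: le_lt_trans (le_outer_measure mu _ _ (@subIsetl _ H G)) _.
  by apply: le_lt_trans lH _; rewrite lte_add_pinfty // ltry.
Qed.

Lemma test_linear_onem (g : test_fun U) (c : V -> R) (sc : forall k, Ck_in k c) :
  T g = T (test_scale sc g) + T (test_scale (Ck_in_onem sc) g).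
Proof.
rewrite -linT.1; congr T; apply: test_fun_eq => x /=.
by rewrite -scalerDl scaleN1r addrC subrK scale1r.
Qed.

(* Cut [h] along the dyadic levels [a i = c / 2 ^+ i] of its norm: the [i]-th layer
   has norm at most [2 * a i] and lives where [|h| > a i / 2], so its image by
   [T] is at most [2 * a i] times the measure of that set.  Summing over [i]
   leaves a geometric series, dominated pointwise by [8 * |h|]. *)
Lemma variation_le_integral (h : test_fun U) :
  ((T h)%:E <= 8%:E * \int[mu']_x (enorm (h x))%:E)%E.
Proof.
have [c c0 hc] := test_fun_enorm_bounded h.
pose a i : R := c / 2 ^+ i.
have a0 i : 0 < a i by rewrite divr_gt0 // exprn_gt0.
have aS i : a i = 2 * a i.+1.
  by rewrite /a exprS; field; rewrite ?expf_neq0 ?pnatr_eq0.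
pose Q i := [set x | a i < enorm (h x)].
have oQ i : open (Q i).
  apply: (open_comp _ (@open_gt _ (a i))) => x _; exact: enorm_test_fun_continuous.
have Qh i : Q i `<=` spt h.
  move=> x; apply: contraPP => /spt_eq0 hx.
  by rewrite /Q /= hx enorm0; apply/negP; rewrite -leNgt ltW.
have QU i : Q i `<=` U by exact: subset_trans (Qh i) (@test_sub _ _ _ h).
have Qnd i : Q i `<=` Q i.+1.
  by move=> x; apply: lt_trans; rewrite (aS i); have := a0 i.+1; lra.
have /choice[chi chiP] (i : nat) : exists c : V -> R, [/\ forall k, Ck_in k c,
    closure [set x | c x != 0] `<=` Q i.+1, forall x, 0 <= c x <= 1 &
    forall x, a i <= enorm (h x) -> c x = 1].
  have cK : compact [set x | a i <= enorm (h x)].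
    apply: subclosed_compact (test_compact (t := h)) _.
      by apply: (closed_comp _ (@closed_ge _ (a i))) => x _; exact: enorm_test_fun_continuous.
    move=> x; apply: contraPP => /spt_eq0 hx.
    by rewrite /= hx enorm0; apply/negP; rewrite -ltNge.
  have KQ : [set x | a i <= enorm (h x)] `<=` Q i.+1.
    by move=> x; apply: lt_le_trans; rewrite (aS i); have := a0 i.+1; lra.
  have [d [sd _ dQ d01 [N [_ KN d1]]]] := smooth_urysohn cK (oQ i.+1) KQ.
  by exists d; split=> // x ax; apply: d1; exact: KN.
have sch i : forall k, Ck_in k (chi i) by have [] := chiP i.
have chi01 i x : 0 <= chi i x <= 1 by have [_ _ + _] := chiP i; apply.
have layers N : ((T (test_scale (sch N) h))%:E <=
    \sum_(i < N.+1) (2 * a i)%:E * mu (Q i.+1))%E.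
  elim: N => [|N IH].
    rewrite big_ord_recl big_ord0 adde0 muT //.
    apply: variation_on_scale => //; first by rewrite mulr_ge0 // ltW.
      by apply: subset_trans (@spt_test_scaleW _ _ _ _ _ _) _; have [] := chiP 0%N.
    move=> x /=; rewrite enormZ; have /andP[x0 x1] := chi01 0%N x.
    rewrite ger0_norm //; have := hc x; have := enorm_ge0 (h x).
    by rewrite /a expr0 divr1; nra.
  have sd k : Ck_in k (fun x => chi N.+1 x + (-1) *: chi N x) by exact: Ck_in_sub.
  have -> : test_scale (sch N.+1) h = test_add (test_scale (sch N) h) (test_scale sd h).
    by apply: test_fun_eq => x /=; rewrite -scalerDl scaleN1r addrC subrK.
  rewrite linT.1 EFinD big_ord_recr /=; apply: leeD => //.
  rewrite muT //; apply: variation_on_scale => //.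
  - by rewrite mulr_ge0 // ltW.
  - apply: (@subset_trans _ (closure [set x | chi N.+1 x != 0] `|`
        closure [set x | chi N x != 0])).
      apply: spt_sub => [|x /=]; first by apply: closedU; exact: closed_closure.
      apply: contraNP => /not_orP[x1 x2].
      have chi0 i : ~ closure [set x | chi i x != 0] x -> chi i x = 0.
        by move=> hx; apply/eqP/negPn/negP => /(@subset_closure _ [set x | chi i x != 0] x).
      by rewrite !chi0 // scaler0 addr0 scale0r.
    have [_ q1 _ _] := chiP N.+1; have [_ q0 _ _] := chiP N.
    by move=> x [/q1 //|/q0]; exact: Qnd.
  - move=> x /=; rewrite enormZ -aS.
    have /andP[x0 x1] := chi01 N x; have /andP[y0 y1] := chi01 N.+1 x.
    (* Where the norm of [h] is at least [a N] both cutoffs are 1 and the layer vanishes; elsewhere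
       that norm is below [a N = 2 * a N.+1]. *)
    have [ax|ax] := leP (a N) (enorm (h x)).
      have -> : chi N x = 1 by have [_ _ _] := chiP N; apply.
      have -> : chi N.+1 x = 1.
        have [_ _ _] := chiP N.+1; apply; apply: le_trans ax.
        by rewrite (aS N); have := a0 N.+1; lra.
      by rewrite scaleN1r subrr normr0 mul0r ltW.
    rewrite scaleN1r; apply: le_trans (ltW ax).
    by rewrite ler_piMl ?enorm_ge0 // ler_norml; apply/andP; split; lra.
have mQ i : mu.-caratheodory (Q i) by exact: (radon_open_caratheodory radmu).
have mQ' i : measurable (Q i : set cara) := mQ i.
have mh : measurable_fun setT (fun x : cara => (enorm (h x))%:E).
  apply/measurable_EFinP.
  apply: continuous_measurable_cara; last exact: enorm_test_fun_continuous.
  exact: (radon_open_caratheodory radmu).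
have layers_int N : (\sum_(i < N) (2 * a i)%:E * mu (Q i.+1) <=
    8%:E * \int[mu']_x (enorm (h x))%:E)%E.
  rewrite (eq_bigr (fun i : 'I_N => \int[mu']_x ((2 * a i) * \1_(Q i.+1) x)%:E))%E; last first.
    move=> i _; under eq_integral do rewrite EFinM.
    rewrite ge0_integralZl //.
    - by rewrite integral_indic // setIT.
    - by apply/measurable_EFinP; exact: measurable_indic.
    - by rewrite lee_fin mulr_ge0 // ltW.
  have mi (i : 'I_N) : measurable_fun setT (fun x : cara => ((2 * a i) * \1_(Q i.+1) x)%:E).
    by apply/measurable_EFinP; apply: measurable_funM => //; exact: measurable_indic.
  have i0 (i : 'I_N) x : (0 <= ((2 * a i) * \1_(Q i.+1) x)%:E)%E.
    by rewrite lee_fin mulr_ge0 // mulr_ge0 // ltW.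
  rewrite -ge0_integral_sum //.
  rewrite -ge0_integralZl //; last by move=> x _; rewrite lee_fin enorm_ge0.
  apply: ge0_le_integral => //.
  - by move=> x _; exact: sume_ge0.
  - exact: (emeasurable_sum _ mi).
  - by apply: (measurable_funeM _ mh).
  move=> x _; rewrite sumEFin -EFinM lee_fin.
  (* On [Q i.+1] the level [a i = 2 * a i.+1] is below twice the norm of [h]; the constant 8 is the
     layer factor 2 times the 4 obtained here. *)
  have [h4 _] := dyadic_sum_le N c0 (enorm_ge0 (h x)).
  apply: (@le_trans _ _ (2 * (4 * enorm (h x)))); last by rewrite mulrA -natrM.
  apply: le_trans (ler_wpM2l (ler0n _ 2) h4); rewrite mulr_sumr; apply: ler_sum => i _.
  rewrite -/(a i) -[leLHS]mulrA indicE; apply: ler_wpM2l => //.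
  apply: ler_wpM2l; first exact: ltW.
  rewrite ler_nat; case: (boolP (x \in Q i.+1)) => //; rewrite inE => Qx.
  suff -> : a i < 2 * enorm (h x) by [].
  by rewrite (aS i) ltr_pM2l.
(* The remainder [(1 - chi N) h] has norm at most [a N] and is supported in [G]; as [mu G] is
   finite, its image under [T] is small for large [N]. *)
have [G [oG GU hG Gfin]] := test_fun_nbhs_finite oU (@subset_refl _ U) (@test_sub _ _ _ h).
apply/lee_addgt0Pr => e e0.
have [N aN] : exists N, ((a N)%:E * mu G <= e%:E)%E.
  have fG : mu G \is a fin_num by rewrite ge0_fin_numE ?outer_measure_ge0.
  pose M := fine (mu G); have M0 : 0 <= M by rewrite fine_ge0.
  exists (Num.trunc (c * M / e)).+1; rewrite -(fineK fG) -EFinM lee_fin -/M.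
  have := truncnS_gt (c * M / e); set k := (Num.trunc _).+1 => kM.
  rewrite /a mulrAC ler_pdivrMr ?exprn_gt0 // [leRHS]mulrC -ler_pdivrMr //.
  apply: le_trans (_ : k%:R <= _); first exact: ltW.
  by rewrite -natrX ler_nat ltnW // ltn_expl.
rewrite (test_linear_onem h (sch N)) EFinD; apply: leeD.
  exact: le_trans (layers N) (layers_int N.+1).
apply: le_trans aN; rewrite muT //; apply: variation_on_scale => //.
- exact: ltW.
- exact: subset_trans (@spt_test_scale _ _ _ _ _ _) hG.
- move=> x /=; rewrite enormZ; have /andP[x0 x1] := chi01 N x.
  have [ax|ax] := leP (a N) (enorm (h x)).
    have -> : chi N x = 1 by have [_ _ _] := chiP N; apply.
    by rewrite scaleN1r subrr normr0 mul0r ltW.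
  rewrite -enormZ; apply: enorm_scale_le (ltW ax).
  by have [] := norm_unit_itv (chi01 N x).
Qed.

End variation_integral.

Section L1_limits.
Context (R : realType) (n : nat) (U : set 'rV[R]_n) (oU : open U).
Local Notation V := 'rV[R]_n.
Variables (T : test_fun U -> R) (mu : {outer_measure set V -> \bar R}).
Hypotheses (linT : test_linear T) (radmu : radon_over U mu)
  (muT : forall G, open G -> G `<=` U -> mu G = variation_on T G).
Local Notation cara := (caratheodory_type mu).
Local Notation mu' := (mu : set cara -> \bar R).

Definition L1_dist (g f : V -> V) : \bar R := (\int[mu']_x (enorm (g x - f x))%:E)%E.

(** When [mu] is the total variation of [T], [L1_extension] is [get] of this set. *)
Definition L1_limits (f : V -> V) : set R := [set l : R | exists g : nat -> test_fun U,
  (L1_dist (g k) f @[k --> \oo] --> 0%E) /\ (T (g k) @[k --> \oo] --> l)].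

Lemma L1_dist_ge0 g f : (0 <= L1_dist g f)%E.
Proof. by apply: integral_ge0 => x _; rewrite lee_fin enorm_ge0. Qed.

Section limit_function.
Variable f : V -> V.
Hypothesis mf : forall h : test_fun U,
  measurable_fun setT (fun x : cara => (enorm (h x - f x))%:E).

(** The constant is 8 from [variation_le_integral] times 2 from [enormD]; the absolute value is
    obtained by treating the difference and its opposite. *)
Lemma variation_dist_le (h1 h2 : test_fun U) :
  ((`|T h1 - T h2|)%:E <= 16%:E * (L1_dist h1 f + L1_dist h2 f))%E.
Proof.
pose d := test_add h1 (test_mulr (-1) h2).
have Td : T d = T h1 - T h2 by rewrite linT.1 linT.2 mulN1r.
have int_d (d' : test_fun U) : (forall x, enorm (d' x) = enorm (d x)) ->
    ((T d')%:E <= 16%:E * (L1_dist h1 f + L1_dist h2 f))%E.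
  move=> d'E; apply: le_trans (variation_le_integral oU linT radmu muT d') _.
  rewrite (_ : 16%:E = 8%:E * 2%:E)%E; last by rewrite -EFinM -natrM.
  rewrite -muleA; apply: lee_wpmul2l; first by rewrite lee_fin.
  rewrite /L1_dist -ge0_integralD //; try by [exact: mf|move=> x _; rewrite lee_fin enorm_ge0].
  rewrite -ge0_integralZl //; last 2 first.
  - by apply: emeasurable_funD; exact: mf.
  - by move=> x _; rewrite adde_ge0 // lee_fin enorm_ge0.
  apply: ge0_le_integral => //.
  - by move=> x _; rewrite lee_fin enorm_ge0.
  - apply/measurable_EFinP; apply: continuous_measurable_cara.
      exact: (radon_open_caratheodory radmu).
    exact: enorm_test_fun_continuous.
  - by apply: measurable_funeM; apply: emeasurable_funD; exact: mf.
  move=> x _; rewrite -EFinD -EFinM lee_fin d'E /= scaleN1r.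
  rewrite -(subrKA (f x)) -[enorm (h2 x - f x)]enormN opprB.
  exact: enormD.
rewrite -Td; have [Td0|Td0] := leP 0 (T d); first by rewrite ger0_norm // int_d.
rewrite ltr0_norm // -mulN1r -linT.2; apply: int_d => x.
by rewrite /= enormZ normrN1 mul1r.
Qed.

Lemma L1_limits_dist (l : R) (h : test_fun U) : L1_limits f l ->
  ((`|l - T h|)%:E <= 16%:E * L1_dist h f)%E.
Proof.
move=> [g [gf gl]]; apply/lee_addgt0Pr => e e0.
have e20 : 0 < e / 2 by rewrite divr_gt0.
have e32 : 0 < e / 32 by rewrite divr_gt0.
have [k [gk lk]] : exists k, (L1_dist (g k) f <= (e / 32)%:E)%E /\ `|l - T (g k)| <= e / 2.
  near \oo => k; exists k; split; last first.
    by near: k; apply: cvgr_dist_le gl _ e20.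
  near: k; have [gfin gf0] := (fine_cvgP _ _).1 gf.
  near=> k; rewrite -[L1_dist _ _]fineK; last by near: k.
  rewrite lee_fin; apply: le_trans (ler_norm _) _; rewrite -[fine _]subr0 distrC.
  by near: k; apply: cvgr_dist_le gf0 _ e32.
apply: (@le_trans _ _ ((e / 2)%:E + (`|T (g k) - T h|)%:E)%E).
  by rewrite -EFinD lee_fin -(subrKA (T (g k))) (le_trans (ler_normD _ _)) // lerD.
have -> : (e%:E = (e / 2)%:E + (e / 2)%:E)%E by rewrite -EFinD -splitr.
rewrite addeC addeA leeD2r //.
apply: le_trans (variation_dist_le (g k) h) _.
rewrite muleDr ?ge0_adde_def ?inE ?L1_dist_ge0 // [leLHS]addeC; apply: leeD => //.
apply: le_trans (lee_wpmul2l _ gk) _ => //.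
by rewrite -EFinM lee_fin; lra.
Unshelve. all: by end_near. Qed.

Lemma L1_limits_nonempty (g : nat -> test_fun U) :
  (forall k, (L1_dist (g k) f <= (k.+1%:R^-1)%:E)%E) -> exists l, L1_limits f l.
Proof.
move=> gf.
have gfin k : L1_dist (g k) f \is a fin_num.
  by rewrite ge0_fin_numE ?L1_dist_ge0 // (le_lt_trans (gf k)) // ltry.
have gf0 : L1_dist (g k) f @[k --> \oo] --> 0%E.
  apply/fine_cvgP; split; first exact: nearW.
  apply: (squeeze_cvgr (f := fun=> 0) (h := harmonic)); [|exact: cvg_cst|exact: cvg_harmonic].
  apply: nearW => k; rewrite /= fine_ge0 ?L1_dist_ge0 //=.
  by rewrite -lee_fin fineK.
suff /cvg_ex[l gl] : cvg (T (g k) @[k --> \oo]) by exists l, g.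
apply/cauchy_cvgP/cauchy_exP => e e0.
(* From [N] on, both distances are at most [1/(N+1)], and 16 times their sum is [32/(N+1)], below
   [e]. *)
pose N := Num.trunc (32 / e); exists (T (g N)).
have N0 : 0 < N.+1%:R :> R by [].
have Ne : 32 / N.+1%:R < e.
  by rewrite ltr_pdivrMr // mulrC -ltr_pdivrMr // truncnS_gt.
exists N => // k /= Nk; rewrite -ball_normE /=; apply: le_lt_trans Ne.
rewrite -lee_fin; apply: le_trans (variation_dist_le _ _) _.
have -> : ((32 / N.+1%:R)%:E = 16%:E * (N.+1%:R^-1%:E + N.+1%:R^-1%:E) :> \bar R)%E.
  by rewrite -EFinD -EFinM; congr EFin; ring.
apply: lee_wpmul2l; first by rewrite lee_fin.
apply: leeD => //; apply: le_trans (gf k) _.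
by rewrite lee_fin lef_pV2 ?posrE // ler_nat.
Qed.

End limit_function.
End L1_limits.

(** * Cutting a functional off *)

Section restricted_functional.
Context (R : realType) (n : nat) (U : set 'rV[R]_n) (oU : open U).
Local Notation V := 'rV[R]_n.
Variables (T : test_fun U -> R) (mu : {outer_measure set V -> \bar R}).
Hypotheses (linT : test_linear T) (radmu : radon_over U mu)
  (muT : forall G, open G -> G `<=` U -> mu G = variation_on T G).
Local Notation cara := (caratheodory_type mu).
Local Notation mu' := (mu : set cara -> \bar R).
Variable E : set V.
Hypothesis mE : mu.-caratheodory E.

Lemma inner_part_exhaustion : open_exhaustion U mu (fun k => (inner_part U k)°).
Proof.
have [_ muK _ _ _] := radmu; split.
- move=> k; apply/(relopen_openE _ oU); split; first exact: open_interior.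
  exact: subset_trans (@interior_subset _ _) (@inner_part_sub _ _ _ _).
- move=> k; apply: le_lt_trans (le_outer_measure mu _ _ (@interior_subset _ _)) _.
  by apply: muK; [exact: inner_part_compact|exact: inner_part_sub].
- by move=> k l kl; apply/subsetPset/interiorS; exact: inner_part_nd.
- exact: inner_part_cover.
Qed.

Definition cut (g : V -> V) : V -> V := fun x => if x \in E then g x else 0.

Lemma cut_measurable (g h : test_fun U) :
  measurable_fun setT (fun x : cara => (enorm (h x - cut g x))%:E).
Proof.
have mE' : measurable (E : set cara) := mE.
have mEc' : measurable (~` E : set cara) := measurableC mE'.
rewrite (_ : (fun _ => _) = fun x => (\1_E x * enorm (h x - g x) +
    \1_(~` E) x * enorm (h x))%:E); last first.
  apply/funext => x; rewrite /cut !indicE in_setC.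
  by case: (x \in E); rewrite /= ?mul1r ?mul0r ?addr0 ?add0r ?subr0.
apply/measurable_EFinP; apply: measurable_funD; apply: measurable_funM.
- exact: measurable_indic.
- apply: continuous_measurable_cara; first exact: (radon_open_caratheodory radmu).
  rewrite (_ : (fun _ => _) = fun x => enorm ((test_add h (test_mulr (-1) g)) x)).
    exact: enorm_test_fun_continuous.
  by apply/funext => x /=; rewrite scaleN1r.
- exact: measurable_indic.
- apply: continuous_measurable_cara; first exact: (radon_open_caratheodory radmu).
  exact: enorm_test_fun_continuous.
Qed.

Section cutoff.
Variables (g : test_fun U) (G : set V).
Hypotheses (g1 : forall x, enorm (g x) <= 1) (oG : open G) (GU : G `<=` U)
  (gG : spt g `<=` G) (Gfin : (mu G < +oo)%E).

(** Choose a compact [K] in the part of [G] in [E] and an open [Q] around [K], each step costing at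
    most [e] in measure, and let [c] be 1 near [K] and supported in [Q]. *)
Lemma cut_approx (e : R) : 0 < e ->
  exists (c : V -> R) (sc : forall k, Ck_in k c),
    [/\ (L1_dist mu (test_scale sc g) (cut g) <= (2 * e)%:E)%E,
        ((T (test_scale sc g))%:E <= mu (G `&` E) + e%:E)%E &
        ((T g - T (test_scale sc g))%:E <= mu (G `&` ~` E) + e%:E)%E].
Proof.
move=> e0; have [_ _ _ _ rU] := radmu.
have hV : hausdorff_space V by exact: norm_hausdorff.
have rG : relopen U G by apply/relopen_openE.
have [K [cK KGE lK]] :=
  radon_inner_approx hV radmu inner_part_exhaustion mE e0 rG Gfin.
have KU : K `<=` U by move=> x /KGE[/GU].
have Kfin : (mu K < +oo)%E.
  apply: le_lt_trans Gfin; apply: le_outer_measure; move=> x /KGE[//].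
have [H [/(relopen_openE _ oU)[oH HU] KH lH]] := outer_regular_adherent rU KU e0 Kfin.
pose Q := H `&` G.
have oQ : open Q by exact: openI.
have KQ : K `<=` Q by move=> x Kx; split; [exact: KH|have [] := KGE _ Kx].
have QU : Q `<=` U by move=> x [_ /GU].
have lQ : (mu Q <= mu K + e%:E)%E.
  by apply: le_trans lH; apply: le_outer_measure; exact: subIsetl.
have [c [sc _ cQ c01 [N [oN KN c1]]]] := smooth_urysohn cK oQ KQ.
have mK : mu.-caratheodory K.
  by apply: (radon_closed_caratheodory radmu); exact: rV_compact_closed.
have mQ : mu.-caratheodory Q by exact: (radon_open_caratheodory radmu).
have mG : mu.-caratheodory G by exact: (radon_open_caratheodory radmu).
have fK : mu K \is a fin_num by rewrite ge0_fin_numE ?outer_measure_ge0.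
have lQK : (mu (Q `\` K) <= e%:E)%E.
  rewrite -(leeD2lE _ _ fK); apply: le_trans lQ.
  by rewrite (mK Q) (_ : Q `&` K = K) //; apply/setIidPr.
exists c, sc; split.
(* Off [A] the fields [c g] and [cut g] coincide; on [A] they differ by at most 1 in norm, so the
   distance is at most [mu A]. *)
- pose A := (G `&` E `\` K) `|` (Q `\` K).
  have mA : measurable (A : set cara).
    apply: caratheodory_measurable_setU; apply: caratheodory_measurable_setD => //.
    exact: caratheodory_measurable_setI.
  have lA : (mu A <= (2 * e)%:E)%E.
    apply: le_trans (outer_measureU2 _ _ _) _.
    by rewrite mulr_natl mulr2n EFinD; apply: leeD.
  have AE : (\int[mu']_x (\1_A x)%:E)%E = mu A by rewrite integral_indic // setIT.
  apply: le_trans lA; rewrite -[leRHS]AE.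
  apply: ge0_le_integral => //.
  + by move=> x _; rewrite lee_fin enorm_ge0.
  + exact: cut_measurable.
  + by apply/measurable_EFinP; exact: measurable_indic.
  move=> x _; rewrite lee_fin /= /cut indicE.
  have /andP[cx0 cx1] := c01 x.
  have [Ax|Ax] := boolP (x \in A).
    have [Ex|Ex] := boolP (x \in E).
      rewrite -[X in _ - X]scale1r -scalerBl enormZ mulr_ile1 ?enorm_ge0 //.
      by rewrite ler_norml; apply/andP; split; lra.
    by rewrite subr0 enormZ mulr_ile1 ?enorm_ge0 // ger0_norm.
  have {}Ax : ~ A x by move: Ax => /negP h Ax; apply: h; rewrite inE.
  have [Kx|Kx] := pselect (K x).
    have -> : x \in E by rewrite inE; have [] := KGE _ Kx.
    by rewrite c1 ?scale1r ?subrr ?enorm0 //; exact: KN.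
  have -> : c x = 0.
    apply/eqP/negPn/negP => cx; apply: Ax; right; split=> //; apply: cQ.
    exact: subset_closure.
  rewrite scale0r; have [Ex|Ex] := boolP (x \in E); last by rewrite subrr enorm0.
  rewrite (@spt_eq0 _ _ g) ?subrr ?enorm0 // => /gG Gx; apply: Ax; left.
  by split=> //; split=> //; rewrite inE in Ex.
- apply: (@le_trans _ _ (mu Q)).
    rewrite muT //; apply: variation_on_ge.
      exact: subset_trans (@spt_test_scaleW _ _ _ _ _ _) cQ.
    by move=> x; apply: enorm_scale_le => //; have [] := norm_unit_itv (c01 x).
  by apply: le_trans lQ _; rewrite leeD2r //; exact: le_outer_measure.
rewrite (test_linear_onem linT g sc) addrAC subrr add0r.
have oGK : open (G `\` K).
  by rewrite setDE; apply: openI => //; apply: closed_openC; exact: rV_compact_closed.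
apply: (@le_trans _ _ (mu (G `\` K))).
  rewrite muT //; last by move=> x [/GU].
  apply: variation_on_ge.
    apply: (@subset_trans _ (spt g `\` N)); first exact: spt_test_scale_onem.
    move=> x [gx Nx].
    by split; [exact: gG|move=> /KN].
  by move=> x; apply: enorm_scale_le => //; have [] := norm_unit_itv (c01 x).
apply: (@le_trans _ _ (mu ((G `&` ~` E) `|` (G `&` E `\` K)))).
  apply: le_outer_measure => x [Gx Kx].
  by have [Ex|Ex] := pselect (E x); [right|left].
by apply: le_trans (outer_measureU2 _ _ _) _; apply: leeD.
Qed.

(* So the [get] in [L1_extension] does not fall back on its default value. *)
Lemma cut_limit : exists l, L1_limits T mu (cut g) l.
Proof.
have h (k : nat) : exists h : test_fun U,
    (L1_dist mu h (cut g) <= (k.+1%:R^-1)%:E)%E.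
  have k0 : 0 < k.+1%:R^-1 / 2 :> R by rewrite divr_gt0.
  have [c [sc [lc _ _]]] := cut_approx k0.
  exists (test_scale sc g); apply: le_trans lc _.
  by rewrite lee_fin mulrC divfK.
have [f fP] := choice h.
exact: (L1_limits_nonempty oU linT radmu muT (cut_measurable g) fP).
Qed.

Lemma cut_limit_le (l : R) : L1_limits T mu (cut g) l ->
  (l%:E <= mu (G `&` E))%E /\ ((T g - l)%:E <= mu (G `&` ~` E))%E.
Proof.
move=> lg; suff h e : 0 < e -> (l%:E <= mu (G `&` E) + e%:E)%E /\
    ((T g - l)%:E <= mu (G `&` ~` E) + e%:E)%E.
  by split; apply/lee_addgt0Pr => e /h[].
(* One share of [e / 33] goes to the estimates of [cut_approx]; the passage to the limit takes 32,
   namely 16 from [L1_limits_dist] times 2. *)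
move=> e0; have e33 : 0 < e / 33 by rewrite divr_gt0.
have [c [sc [lc T1 T2]]] := cut_approx e33.
have lT : `|l - T (test_scale sc g)| <= 32 * (e / 33).
  rewrite -lee_fin.
  apply: le_trans (L1_limits_dist oU linT radmu muT (cut_measurable g) _ lg) _.
  apply: (@le_trans _ _ (16%:E * (2 * (e / 33))%:E)%E).
    by apply: lee_wpmul2l => //; rewrite lee_fin.
  by rewrite -EFinM lee_fin; lra.
move: lT; rewrite ler_norml => /andP[lT1 lT2].
have eE : (e%:E = (e / 33)%:E + (32 * (e / 33))%:E :> \bar R)%E.
  by rewrite -EFinD; congr EFin; field.
rewrite eE !addeA; split.
  apply: le_trans (leeD2r _ T1); rewrite -EFinD lee_fin; lra.
apply: le_trans (leeD2r _ T2); rewrite -EFinD lee_fin; lra.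
Qed.

End cutoff.

Section decomposition.
Variables S S' : test_fun U -> R.
Hypotheses (SE : forall g, S g = get (L1_limits T mu (cut g)))
  (S'E : forall g, T g = S g + S' g).

Lemma restricted_variation_le (g : test_fun U) (G : set V) : open G -> G `<=` U ->
  spt g `<=` G -> (forall x, enorm (g x) <= 1) ->
  ((S g)%:E <= mu (G `&` E))%E /\ ((S' g)%:E <= mu (G `&` ~` E))%E.
Proof.
move=> oG GU gG g1.
have [H [oH HG gH Hfin]] := test_fun_nbhs_finite oU radmu oG GU gG.
have HU : H `<=` U by exact: subset_trans GU.
have lP := cut_limit g1 oH HU gH Hfin.
have := cut_limit_le g1 oH HU gH Hfin (getPex lP); rewrite -SE => -[h1 h2].
have -> : S' g = T g - S g by rewrite S'E addrAC subrr add0r.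
by split; [apply: le_trans h1 _|apply: le_trans h2 _]; apply: le_outer_measure; exact: setSI.
Qed.

Lemma restricted_variation_on (G : set V) : open G -> G `<=` U ->
  variation_on S G = mu (G `&` E) /\ variation_on S' G = mu (G `&` ~` E).
Proof.
have le1 H : open H -> H `<=` U -> (variation_on S H <= mu (H `&` E))%E.
  move=> oH HU; apply: ge_ereal_sup => _ [g [gH g1] <-].
  by have [] := restricted_variation_le oH HU gH g1.
have le2 H : open H -> H `<=` U -> (variation_on S' H <= mu (H `&` ~` E))%E.
  move=> oH HU; apply: ge_ereal_sup => _ [g [gH g1] <-].
  by have [] := restricted_variation_le oH HU gH g1.
have sum H : open H -> H `<=` U -> (mu H <= variation_on S H + variation_on S' H)%E.
  move=> oH HU; rewrite muT //; apply: ge_ereal_sup => _ [g [gH g1] <-].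
  by rewrite S'E EFinD; apply: leeD; exact: variation_on_ge.
(* The upper bounds can be cancelled from the lower bound on the sum only when they are finite; the
   exhaustion then handles a general [G]. *)
have fin H : open H -> H `<=` U -> (mu H < +oo)%E ->
    (mu (H `&` E) <= variation_on S H)%E /\ (mu (H `&` ~` E) <= variation_on S' H)%E.
  move=> oH HU Hfin; have := sum H oH HU; have := le1 H oH HU; have := le2 H oH HU.
  have f1 : mu (H `&` E) \is a fin_num.
    rewrite ge0_fin_numE ?outer_measure_ge0 //; apply: le_lt_trans Hfin.
    by apply: le_outer_measure; exact: subIsetl.
  have f2 : mu (H `&` ~` E) \is a fin_num.
    rewrite ge0_fin_numE ?outer_measure_ge0 //; apply: le_lt_trans Hfin.
    by apply: le_outer_measure; exact: subIsetl.
  rewrite (mE H) => s2 s1 s12; split.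
    rewrite -(leeD2rE _ _ f2); apply: le_trans s12 _; exact: leeD2l.
  rewrite -(leeD2lE _ _ f1); apply: le_trans s12 _; exact: leeD2r.
move=> oG GU.
pose Y k := (inner_part U k)°.
have [Yo Yfin Ynd UY] := inner_part_exhaustion.
have GYfin k : (mu (G `&` Y k) < +oo)%E.
  by apply: le_lt_trans (Yfin k); apply: le_outer_measure; exact: subIsetr.
have oGY k : open (G `&` Y k) by apply: openI => //; exact: open_interior.
have GYU k : G `&` Y k `<=` U by move=> x [/GU].
have mGY k : mu.-caratheodory (G `&` Y k) by exact: (radon_open_caratheodory radmu).
have GY Z : mu.-caratheodory Z -> forall M, (forall k, (mu (G `&` Y k `&` Z) <= M)%E) ->
    (mu (G `&` Z) <= M)%E.
  move=> mZ M; apply: nondecreasing_caratheodory_le.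
  - by move=> k; exact: caratheodory_measurable_setI.
  - move=> k l kl; apply/subsetPset; apply: setSI; apply: setIS.
    by apply/subsetPset; exact: Ynd.
  - by move=> x [Gx Zx]; have [k _ Yx] := UY x (GU _ Gx); exists k.
split; apply/eqP; rewrite eq_le; apply/andP; split.
- exact: le1.
- apply: GY => // k; have [h _] := fin _ (oGY k) (GYU k) (GYfin k).
  by apply: le_trans h _; apply: le_variation_on; exact: subIsetl.
- exact: le2.
- apply: GY => [|k]; first exact: caratheodory_measurable_setC.
  have [_ h] := fin _ (oGY k) (GYU k) (GYfin k).
  by apply: le_trans h _; apply: le_variation_on; exact: subIsetl.
Qed.

(** The restriction of a Radon measure to a measurable set is again outer regular, so
    [dist_variationE] recognises it from its values on open sets. *)
Lemma dist_variation_orestr (Z : set V) (S0 : test_fun U -> R) : mu.-caratheodory Z ->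
  (forall G, open G -> G `<=` U -> variation_on S0 G = mu (G `&` Z)) ->
  forall A, dist_variation S0 A = mu (A `&` Z).
Proof.
move=> mZ SZ; have hV : hausdorff_space V by exact: norm_hausdorff.
have [Z0 _ mrO _ rZ] := orestr_radon hV radmu inner_part_exhaustion mZ.
apply: (@dist_variationE _ _ _ oU S0 (orestr mu Z)) => //.
split; first exact: outer_regular_borel.
by move=> G oG GU; rewrite [RHS]SZ.
Qed.

Lemma dist_variation_split (A : set V) :
  mu A = (dist_variation S A + dist_variation S' A)%E.
Proof.
rewrite (dist_variation_orestr mE) => [|G oG GU]; last first.
  by have [] := restricted_variation_on oG GU.
have mEC := caratheodory_measurable_setC mE.
rewrite (dist_variation_orestr mEC) => [|G oG GU]; last first.
  by have [] := restricted_variation_on oG GU.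
exact: mE.
Qed.

End decomposition.
End restricted_functional.

(** * Restriction of varifolds *)

Section varifold_restriction.
Context (R : realType) (n m : nat) (U : set 'rV[R]_n) (oU : open U).
Local Notation Gr := (@grassmannian R n m).
Local Notation pairs := ('rV[R]_n * subspaces R n)%type.
Local Open Scope ereal_scope.
Implicit Types V : {outer_measure set pairs -> \bar R}.

Lemma varifold_locally_finite V : varifold m U V -> locally_finite_borel U V.
Proof.
move=> [V0 Kfin mV _ _]; split=> [G oG|K cK KU].
  exact: (open_caratheodory V0 mV oG).
rewrite -(outer_measure_null _ V0).
apply: (@le_lt_trans _ _ (V (K `*` Gr))).
  by apply: le_outer_measure => -[x S] [[/= Kx _] [_ GS]].
apply: Kfin; first by apply: compact_setX => //; exact: grassmannian_compact.
by move=> [x S] [/= /KU].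
Qed.

Lemma cylinder_exhaustion V : varifold m U V ->
  open_exhaustion (U `*` Gr) V (fun k => (inner_part U k)° `*` Gr).
Proof.
move=> varV; split.
- move=> k; apply: relopen_cylinder; first exact: open_interior.
  exact: subset_trans (@interior_subset _ _) (@inner_part_sub _ _ _ _).
- by move=> k; exact: (weight_inner_part varV).
- move=> k l kl; apply/subsetPset => -[x S] [/= xk GS]; split=> //=.
  by apply: interiorS xk; exact: inner_part_nd.
- move=> [x S] [/= Ux GS]; have [k _ Yx] := inner_part_cover oU Ux.
  by exists k.
Qed.

Lemma varifold_orestr V (Z : set pairs) : varifold m U V -> V.-caratheodory Z ->
  varifold m U (orestr V Z).
Proof.
move=> varV mZ.
have hP : hausdorff_space pairs.
  by apply: hausdorff_setX; [exact: norm_hausdorff|exact: subspaces_hausdorff].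
exact: (orestr_radon hP varV (cylinder_exhaustion varV) mZ).
Qed.

(** The restriction of [V] to the complement of the cylinder is a witness, so [the_measure] does not
    default. Later steps use only these two properties of the difference. *)
Lemma varifold_subP V (E : set 'rV[R]_n) : varifold m U V ->
  V.-caratheodory (E `*` Gr) ->
  varifold m U (varifold_sub m U V (varifold_restr m V E)) /\
  forall A, V A = varifold_restr m V E A +
    varifold_sub m U V (varifold_restr m V E) A.
Proof.
move=> varV mZ; rewrite /varifold_sub /the_measure.
case: pselect => [h|]; first by case: cid.
case; exists (orestr V (~` (E `*` Gr))); split=> [|A]; last exact: mZ.
by apply: varifold_orestr => //; exact: caratheodory_measurable_setC.
Qed.

End varifold_restriction.

Theorem lemma3p4 (R : realType) (m n : nat) (m_gt0 : (0 < m)%N)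
    (n_gt0 : (0 < n)%N) (le_mn : (m <= n)%N)
    (U : set 'rV[R]_n) (oU : open U)
    (V : {outer_measure set ('rV[R]_n * subspaces R n)%type -> \bar R})
    (varV : varifold m U V)
    (radon_dV : radon_over U (dist_variation (first_variation U V)))
    (E : set 'rV[R]_n) (subE : E `<=` U)
    (measE : (fun A => weight m V A +
       dist_variation (first_variation U V) A)%E.-caratheodory E)
    (bdryE : forall g : test_fun U, dist_boundary m U V E g = 0) :
  let W := varifold_restr m V E in
  forall A : set 'rV[R]_n,
    dist_variation (first_variation U V) A =
    (dist_variation (first_variation U W) A +
     dist_variation (first_variation U (varifold_sub m U V W)) A)%E.
Proof.
move=> W A; set D := varifold_sub m U V W.
have lfV := varifold_locally_finite varV.
have linT := first_variation_linear lfV.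
have muT G : open G -> G `<=` U ->
    dist_variation (first_variation U V) G = variation_on (first_variation U V) G.
  by move=> oG GU; rewrite dist_variation_outer // variation_outer_open.
have mu_fin k : (dist_variation (first_variation U V) (inner_part U k)° < +oo)%E.
  by have [_ + _ _] := inner_part_exhaustion oU radon_dV; apply.
have mZ := caratheodory_cylinder oU varV subE measE mu_fin.
have mE : (dist_variation (first_variation U V)).-caratheodory E.
  apply: (@caratheodory_sumr _ _ (weight m V) _ E (fun k => (inner_part U k)°)).
  - by move=> B; exact: outer_measure_ge0.
  - exact: le_weight.
  - exact: weight_subadditive.
  - exact: measE.
  - by move=> k; apply: (radon_open_caratheodory radon_dV); exact: open_interior.
  - exact: (weight_inner_part varV).
  - exact: mu_fin.
  - exact: subset_trans subE (inner_part_cover oU).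
have [varD VE] := varifold_subP oU varV mZ.
have varW : varifold m U W by exact: varifold_orestr.
apply: (dist_variation_split oU linT radon_dV muT mE).
(* The cut-off functional [dist_restr] unfolds to [get] of [L1_limits], and the vanishing boundary
   equates it with the first variation of [W]. *)
- by move=> g; apply/esym/eqP; rewrite -subr_eq0; apply/eqP; exact: bdryE.
- exact: (first_variation_sum lfV (varifold_locally_finite varW)
    (varifold_locally_finite varD) VE).
Qed.
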